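(* Let $M_2^3$ be a 3-dimensional semi-Riemannian manifold of index $2$, isometrically immersed as a totally umbilical submanifold in a 4-dimensional semi-Riemannian manifold $\tilde M_2^4$ of index $2$, with second fundamental form $B$, mean curvature vector field $H$, and ambient Levi-Civita connection $\tilde\nabla$. Suppose that for every null helix $\gamma$ in $M_2^3$ with null Frenet frame $\{\zeta,N,W\}$ and curvatures $h,k_1,k_2$ (where $h\neq 0$ and $h^2+2k_1k_2$ is constant), $\gamma$ preserves its null helical properties with the same functional invariant under the ambient connection, i.e. $$\tilde\nabla_\zeta\tilde\nabla_\zeta\tilde\nabla_\zeta\zeta=(h^2+2k_1k_2)\,\tilde\nabla_\zeta\zeta$$ along $\gamma$. Then $M_2^3$ is a null-totally geodesic hypersurface: $B$ vanishes identically along all lightlike directions, i.e. $B(v,v)=0$ for every null tangent vector $v$ of $M_2^3$, and the mean curvature vector field vanishes, $H=0$.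
   Context: $M_2^3$ denotes a 3-dimensional semi-Riemannian manifold whose metric $g$ has index $2$ (signature $(-,-,+)$), with Levi-Civita connection $\nabla$; $\tilde M_2^4$ is a 4-dimensional semi-Riemannian manifold of index $2$ with Levi-Civita connection $\tilde\nabla$ and metric also denoted $g$. Submanifold notation: for tangent vector fields $X,Y$ on $M_2^3$, the second fundamental form $B$ (normal-bundle-valued, symmetric) is defined by the Gauss formula $\tilde\nabla_XY=\nabla_XY+B(X,Y)$. The mean curvature vector field is $H=\frac13\sum_{j=1}^3\varepsilon_jB(E_j,E_j)$ for an orthonormal frame $\{E_j\}$ of $M_2^3$ with $\varepsilon_j=g(E_j,E_j)=\pm1$. The submanifold is totally umbilical if $B(X,Y)=g(X,Y)H$ for all tangent vector fields $X,Y$. Null curves and helices: a smooth curve $\gamma:I\to M_2^3$ is null if its tangent vector field $\zeta=d\gamma/dt$ (nowhere zero) satisfies $g(\zeta,\zeta)=0$. A screen vector bundle $S(T\gamma^\perp)$ is a (rank 1, non-degenerate) subbundle complementary to $T\gamma$ in $T\gamma^\perp=\bigcup_{P\in\gamma}\{W_P\in T_PM:g(W_P,\zeta_P)=0\}$. Given a screen vector bundle, there is a unique vector field $N$ along $\gamma$ with $g(\zeta,N)=1$, $g(N,N)=0$, $g(N,X)=0$ for all sections $X$ of $S(T\gamma^\perp)$. With $W$ a section of $S(T\gamma^\perp)$ satisfying $g(W,W)=-1$, the null Frenet frame is $\{\zeta,N,W\}$ and the smooth curvature functions $h,k_1,k_2$ are defined by $$\nabla_\zeta\zeta=h\zeta+k_1W,\qquad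 \nabla_\zeta N=-hN+k_2W,\qquad \nabla_\zeta W=k_2\zeta+k_1N.$$ The null curve $\gamma$ is a null helix if $h,k_1,k_2$ are non-zero constants along $I$. In the displayed hypothesis, $\zeta$ is regarded as a vector field along $\gamma$ in $\tilde M_2^4$ and differentiated with $\tilde\nabla$. The ''functional invariant'' of a null helix is the constant $h^2+2k_1k_2$. *)

(* Defs.v *)
(* MathComp-Analysis; R is an arbitrary realType. *)
From HB Require Import structures.
From mathcomp Require Import all_boot all_order all_algebra.
From mathcomp Require Import all_classical all_reals all_analysis.

Set Implicit Arguments.
Unset Strict Implicit.
Unset Printing Implicit Defensive.

Import Order.TTheory GRing.Theory Num.Theory numFieldNormedType.Exports.

Local Open Scope classical_set_scope.
Local Open Scope ring_scope.

(* Used on open sets U of finite-dimensional spaces, where f is C^(k+1) iff it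
   is continuous and all its directional derivatives exist and are C^k. *)
Fixpoint Ck (R : realType) (V W : normedModType R) (k : nat) (U : set V)
    (f : V -> W) : Prop :=
  (forall x, U x -> {for x, continuous f}) /\
  match k with
  | 0%N => True
  | k'.+1 => forall v : V,
      (forall x, U x -> derivable f x v) /\ Ck k' U ('D_v f)
  end.

Definition smooth (R : realType) (V W : normedModType R) (U : set V)
  (f : V -> W) : Prop := forall k, Ck k U f.

(* A smooth atlas indexed by [chart]; it need not be maximal. The maps [phi c]
   and [psi c] are total, but only matter on [dom c] and its image.
   [chart_at p] is a preferred chart around p: choosing one is no restriction. *)
Record manifold (R : realType) (n : nat) := Manifold {
  pts :> topologicalType;
  chart : Type;
  dom : chart -> set pts;
  phi : chart -> pts -> 'rV[R]_n;
  psi : chart -> 'rV[R]_n -> pts;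
  chart_at : pts -> chart;
  pts_hausdorff : hausdorff_space pts;
  pts_second_countable : @second_countable pts;
  dom_open : forall c, open (dom c);
  dom_chart_at : forall p, dom (chart_at p) p;
  img_open : forall c, open (phi c @` dom c);
  phiK : forall c p, dom c p -> psi c (phi c p) = p;
  phi_continuous : forall c p, dom c p -> {for p, continuous (phi c)};
  psi_continuous : forall c x, (phi c @` dom c) x -> {for x, continuous (psi c)};
  transition_smooth : forall c d,
    smooth (phi c @` (dom c `&` dom d)) (phi d \o psi c)
}.

(* The tangent space at p is identified with R^n by means of [chart_at p]. *)
Definition tangent (R : realType) (n : nat) (M : manifold R n) (p : M) : Type :=
  'rV[R]_n.

Section Calculus.
Context {R : realType}.

Section OneManifold.
Context {n : nat} {M : manifold R n}.

Definition vfield : Type := M -> 'rV[R]_n.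

(* The differential at p, applied to u in T_p M, of a map to a vector space. *)
Definition tdiff (W : normedModType R) (F : M -> W) (p : M) (u : tangent p) : W :=
  'D_u (F \o psi (chart_at p)) (phi (chart_at p) p).

Definition smooth_on (W : normedModType R) (U : set M) (F : M -> W) : Prop :=
  forall c : chart M, smooth (phi c @` (dom c `&` U)) (F \o psi c).

(* The components in the chart c of the tangent vector u at p. *)
Definition coords (c : chart M) (p : M) (u : tangent p) : 'rV[R]_n :=
  tdiff (phi c) u.

(* The vector field on [dom c] whose components in the chart c are constant,
   equal to u; for u = e_i it is the coordinate vector field d/dx^i. *)
Definition const_field (c : chart M) (u : 'rV[R]_n) : vfield :=
  fun q => 'D_u (phi (chart_at q) \o psi c) (phi c q).

Definition vfield_smooth (U : set M) (X : vfield) : Prop :=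
  forall c, smooth_on (U `&` dom c) (fun p => coords c (X p : tangent p)).

Definition lie (X : vfield) (F : M -> R) : M -> R :=
  fun p => tdiff F (X p : tangent p).

End OneManifold.
Arguments vfield {n} M.

(* A bilinear form is given by its Gram matrix G. *)
Definition bform (n : nat) (G : 'M[R]_n) (u v : 'rV[R]_n) : R :=
  (u *m G *m v^T) 0 0.

Definition neg_def_on (n : nat) (G W : 'M[R]_n) : Prop :=
  forall w : 'rV[R]_n, (w <= W)%MS -> w != 0 -> bform G w w < 0.

(* q is the largest dimension of a subspace on which G is negative definite *)
Definition has_index (n : nat) (G : 'M[R]_n) (q : nat) : Prop :=
  (exists W : 'M[R]_n, neg_def_on G W /\ \rank W = q) /\
  (forall W : 'M[R]_n, neg_def_on G W -> (\rank W <= q)%N).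

Record metric (n : nat) (M : manifold R n) (q : nat) := Metric {
  gram : M -> 'M[R]_n;
  gram_sym : forall p, (gram p)^T = gram p;
  gram_nondegenerate : forall p, gram p \in unitmx;
  gram_index : forall p, has_index (gram p) q;
  gram_smooth : forall (U : set M) (X Y : vfield M), open U ->
    vfield_smooth U X -> vfield_smooth U Y ->
    smooth_on U (fun p => bform (gram p) (X p) (Y p) : R)
}.

Definition inner (n : nat) (M : manifold R n) (q : nat) (g : metric M q) (p : M)
  (u v : tangent p) : R := bform (gram g p) u v.

Definition lightlike (n : nat) (M : manifold R n) (q : nat) (g : metric M q)
  (p : M) (u : tangent p) : Prop := u != 0 /\ inner g u u = 0.

Section Connection.
Context {n : nat} {M : manifold R n}.
Implicit Types (U : set M) (X Y Z : vfield M) (nabla : vfield M -> vfield M -> vfield M).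

(* Fields are total functions, smooth only on the open set U under
   consideration; these axioms make (nabla X Y) p depend only on the values of
   X and Y near p. *)
Record is_connection nabla : Prop := IsConnection {
  nabla_smooth : forall U X Y, open U ->
    vfield_smooth U X -> vfield_smooth U Y -> vfield_smooth U (nabla X Y);
  nabla_linear : forall U X X' Y (a : M -> R), open U ->
    vfield_smooth U X -> vfield_smooth U X' -> vfield_smooth U Y ->
    smooth_on U a -> forall p, U p ->
    nabla (fun q => a q *: X q + X' q) Y p =
      a p *: nabla X Y p + nabla X' Y p;
  nabla_leibniz : forall U X Y Y' (a : M -> R), open U ->
    vfield_smooth U X -> vfield_smooth U Y -> vfield_smooth U Y' ->
    smooth_on U a -> forall p, U p ->
    nabla X (fun q => a q *: Y q + Y' q) p =
      lie X a p *: Y p + a p *: nabla X Y p + nabla X Y' p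
}.

Record is_levi_civita (q : nat) (g : metric M q) nabla : Prop := IsLeviCivita {
  lc_connection : is_connection nabla;
  (* nabla_X Y - nabla_Y X = [X, Y], as derivations on functions *)
  lc_torsion_free : forall U X Y (F : M -> R), open U ->
    vfield_smooth U X -> vfield_smooth U Y -> smooth_on U F ->
    forall p, U p ->
    lie (nabla X Y) F p - lie (nabla Y X) F p =
      lie X (lie Y F) p - lie Y (lie X F) p;
  lc_metric : forall U X Y Z, open U ->
    vfield_smooth U X -> vfield_smooth U Y -> vfield_smooth U Z ->
    forall p, U p ->
    lie X (fun r => inner g (Y r : tangent r) (Z r)) p =
      inner g (nabla X Y p : tangent p) (Z p) +
      inner g (Y p : tangent p) (nabla X Z p)
}.

(* The formula (dv^k + Gamma^k_ij x^i v^j) d/dx^k, in the chart [chart_at p],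
   for the covariant derivative at p, with velocity x, of a field with value v
   whose components have derivative dv; indeed
   Gamma^k_ij d/dx^k = nabla_(d/dx^i) d/dx^j and nabla is R-bilinear. *)
Definition cov (nabla : vfield M -> vfield M -> vfield M) (p : M)
    (x v dv : 'rV[R]_n) : 'rV[R]_n :=
  let c := chart_at p in dv + nabla (const_field c x) (const_field c v) p.

(* Curves and vector fields along them; only values on an interval matter. *)
Definition velocity (gam : R -> M) : R -> 'rV[R]_n :=
  fun t => 'D_1 (phi (chart_at (gam t)) \o gam) t.

Definition curve_smooth (I : set R) (gam : R -> M) : Prop :=
  (forall t, I t -> {for t, continuous gam}) /\
  (forall c, smooth (I `&` gam @^-1` dom c) (phi c \o gam)).

Definition along_smooth (I : set R) (gam : R -> M) (V : R -> 'rV[R]_n) : Prop :=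
  forall c, smooth (I `&` gam @^-1` dom c)
    (fun t => coords c (V t : tangent (gam t))).

Definition cov_along nabla (gam : R -> M) (V : R -> 'rV[R]_n) : R -> 'rV[R]_n :=
  fun t => cov nabla (gam t) (velocity gam t) (V t)
    ('D_1 (fun s => coords (chart_at (gam t)) (V s : tangent (gam s))) t).

End Connection.

Section Helix.
Context {M : manifold R 3} {q : nat}.
Variables (g : metric M q) (nabla : vfield M -> vfield M -> vfield M).
Implicit Types (I : set R) (gam : R -> M).

Definition null_curve I gam : Prop :=
  [/\ open I, is_interval I, I !=set0, curve_smooth I gam &
      forall t, I t -> lightlike g (velocity gam t : tangent (gam t))].

(* S t is a line in T_(gam t) M, given as the row space of a matrix. *)
Definition screen_bundle I gam (S : R -> 'M[R]_3) : Prop :=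
  forall t, I t ->
  let z := velocity gam t in
  [/\ \rank (S t) = 1%N,
      forall w : 'rV[R]_3, (w <= S t)%MS -> w != 0 ->
        exists2 w' : 'rV[R]_3, (w' <= S t)%MS &
          inner g (w : tangent (gam t)) w' != 0,
      (z :&: S t = 0)%MS &
      forall w : 'rV[R]_3,
        (w <= z + S t)%MS <-> inner g (w : tangent (gam t)) z = 0].

Definition null_frenet_frame I gam (S : R -> 'M[R]_3) (N W : R -> 'rV[R]_3) :
    Prop :=
  [/\ along_smooth I gam N, along_smooth I gam W &
  forall t, I t ->
    let ip := fun u v : 'rV[R]_3 => inner g (u : tangent (gam t)) v in
    [/\ ip (velocity gam t) (N t) = 1,
        ip (N t) (N t) = 0,
        forall w : 'rV[R]_3, (w <= S t)%MS -> ip (N t) w = 0,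
        (W t <= S t)%MS &
        ip (W t) (W t) = -1]].

Definition frenet_equations I gam (N W : R -> 'rV[R]_3)
    (h k1 k2 : R -> R) : Prop :=
  forall t, I t ->
  let z := velocity gam in
  [/\ cov_along nabla gam z t = h t *: z t + k1 t *: W t,
      cov_along nabla gam N t = - h t *: N t + k2 t *: W t &
      cov_along nabla gam W t = k2 t *: z t + k1 t *: N t].

Definition null_helix I gam S N W (h k1 k2 : R) : Prop :=
  [/\ null_curve I gam,
      screen_bundle I gam S,
      null_frenet_frame I gam S N W,
      frenet_equations I gam N W (fun=> h) (fun=> k1) (fun=> k2) &
      [/\ h != 0, k1 != 0 & k2 != 0]].

End Helix.

Section Immersion.
Context {n m : nat} {M : manifold R n} {M' : manifold R m}.
Implicit Types (f : M -> M').

Definition dmap f (p : M) (u : tangent p) : tangent (f p) :=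
  tdiff (phi (chart_at (f p)) \o f) u.

Definition map_smooth f : Prop :=
  continuous f /\
  forall d, smooth_on (f @^-1` dom d) (phi d \o f).

Definition isometric_immersion (q q' : nat) (g : metric M q)
    (g' : metric M' q') f : Prop :=
  [/\ map_smooth f,
      forall p (u : tangent p), dmap f u = 0 -> u = 0 &
      forall p (u v : tangent p), inner g' (dmap f u) (dmap f v) = inner g u v].

(* nabla'_X Z for X tangent to M and Z a vector field of M' along f *)
Definition cov_map (nabla' : vfield M' -> vfield M' -> vfield M') f
    (X : vfield M) (Z : M -> 'rV[R]_m) : M -> 'rV[R]_m :=
  fun p => cov nabla' (f p) (dmap f (X p : tangent p)) (Z p)
    (tdiff (fun r => coords (chart_at (f p)) (Z r : tangent (f r)))
          (X p : tangent p)).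

(* A bilinear map T_p M x T_p M -> T_(f p) M' at each point p. *)
Definition tensor_along (f : M -> M') : Type :=
  forall p : M, tangent p -> tangent p -> tangent (f p).

Record is_second_fundamental_form (q' : nat) (g' : metric M' q')
    (nabla : vfield M -> vfield M -> vfield M)
    (nabla' : vfield M' -> vfield M' -> vfield M')
    f (B : tensor_along f) : Prop := IsSFF {
  sff_normal : forall p (u v w : tangent p),
    inner g' (B p u v) (dmap f w) = 0;
  sff_sym : forall p (u v : tangent p), B p u v = B p v u;
  sff_gauss : forall (U : set M) (X Y : vfield M), open U ->
    vfield_smooth U X -> vfield_smooth U Y -> forall p, U p ->
    cov_map nabla' f X (fun r => dmap f (Y r : tangent r)) p =
      dmap f (nabla X Y p : tangent p) + B p (X p) (Y p)
}.

Definition orthonormal (q : nat) (g : metric M q) (p : M)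
    (E : 'I_n -> tangent p) : Prop :=
  (forall i j, i != j -> inner g (E i) (E j) = 0) /\
  (forall i, inner g (E i) (E i) = 1 \/ inner g (E i) (E i) = -1).

Definition is_mean_curvature (q : nat) (g : metric M q) f (B : tensor_along f)
    (H : forall p, tangent (f p)) : Prop :=
  forall p (E : 'I_n -> tangent p), orthonormal g E ->
    H p = n%:R^-1 *: \sum_(j < n) (inner g (E j) (E j) *: (B p (E j) (E j) : 'rV[R]_m)).

Definition totally_umbilical (q : nat) (g : metric M q) f (B : tensor_along f)
    (H : forall p, tangent (f p)) : Prop :=
  forall p (u v : tangent p), B p u v = inner g u v *: (H p : 'rV[R]_m).

End Immersion.
End Calculus.
Arguments vfield {R n} M.

(* Main.v *)
Require Import Defs.
From HB Require Import structures.
From mathcomp Require Import all_boot all_order all_algebra.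
From mathcomp Require Import all_classical all_reals all_analysis.
From mathcomp Require Import ring lra zify.

Set Implicit Arguments.
Unset Strict Implicit.
Unset Printing Implicit Defensive.

Import Order.TTheory GRing.Theory Num.Theory numFieldNormedType.Exports.

Local Open Scope classical_set_scope.
Local Open Scope ring_scope.

(** For a null vector v, umbilicity gives B(v,v) = g(v,v) H = 0. The content of
    the theorem is H = 0.

    Let gam be a null helix with frame zeta, N, W. The Gauss formula and
    umbilicity give, for a tangent field V along gam,
      D (f_* V) = f_* (nabla_zeta V) + g(zeta, V) H        ([gauss_along]),
    so that the coefficient of H is the N-component of V. The fields zeta and
    nabla_zeta zeta = h zeta + k1 W have none, and the second covariant
    derivative of zeta has N-component k1^2. Hence the third ambient derivative
    of zeta is
      f_* (nabla_zeta^3 zeta) + k1^2 H.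
    The matrix A of the Frenet equations has trace and determinant zero, so by
    Cayley-Hamilton A^3 = (h^2 + 2 k1 k2) A ([frenet_mx_cube]): the tangential
    part already equals (h^2 + 2 k1 k2) D zeta, and the hypothesis on helices
    reads k1^2 H = 0 along gam.

    What remains is that a null helix passes through every point
    ([null_helix_exists]). In a chart the Frenet equations are an autonomous
    differential equation for the position and the frame, with a smooth right
    hand side built from the Christoffel symbols. Picard iteration solves it
    ([picard]), and the solution is smooth because its derivative is a smooth
    function of itself ([smooth_ode]). The Gram matrix G of the frame satisfies
    G' = A G + G A^T, for which the Gram matrix of a null frame is a stationary
    solution; uniqueness for linear equations ([linear_ode_zero]) keeps the frame
    null ([moving_frame_exists]). An initial null frame exists because the metric
    has index 2 in dimension 3 ([null_triple_exists]).

    The calculus behind this starts from directional derivatives: the mean value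
    inequality shows that a function with continuous directional derivatives is
    differentiable ([C1_differentiable_mx]), which yields the chain rule and the
    stability of C^k maps under composition ([Ck_comp]). On the geometric side,
    a connection is an operation on globally defined fields that are smooth only
    on an open set; [nabla_local] and [nabla_tensorial] recover its pointwise
    nature, and [cov_along_sum], [cov_along_field] compute covariant derivatives
    along curves by the Leibniz rule. *)

(** * Mean value inequality and differentiability of C^1 maps *)

Section Calculus.
Context {R : realType}.
Implicit Types V W : normedModType R.

Lemma derive_line V W (f : V -> W) x v :
  'D_v f x = 'D_1 (fun h : R => f (h *: v + x)) 0.
Proof.
rewrite /derive; set g1 := fun h => h^-1 *: _; set g2 := fun h => h^-1 *: _.
suff -> : g1 = g2 by [].
by apply/funext => h; rewrite /g1 /g2 /= addr0 scale0r add0r [_%:A]mulr1.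
Qed.

Lemma is_derive_cvg V W (f : V -> W) x v l :
  (fun h => h^-1 *: ((f \o shift x) (h *: v) - f x)) @ 0^' --> l ->
  is_derive x v f l.
Proof.
move=> fl; apply: DeriveDef; first by apply/cvg_ex; exists l.
exact/cvg_lim.
Qed.

(** Restricting G to the line through x in the direction v reduces the statement
    to the chain rule for differentiable maps. *)
Lemma is_derive_comp V W (X : normedModType R) (G : V -> W) (F : W -> X) x v w :
  differentiable F (G x) -> is_derive x v G w ->
  is_derive x v (F \o G) ('d F (G x) w).
Proof.
move=> dF [dG Gw].
pose g := fun h : R => G (h *: v + x).
have g0 : g 0 = G x by rewrite /g scale0r add0r.
have dg : differentiable g 0 by apply/derivable1_diffP/(derivable1P _ _ _).1.
have dF' : differentiable F (g 0) by rewrite g0.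
have dFg : differentiable (F \o g) 0 by apply: differentiable_comp.
apply: DeriveDef.
  apply/derivable1P.
  by have /derivable1_diffP := dFg.
rewrite (derive_line (F \o G)) -[LHS]/('D_1 (F \o g) 0) deriveE//.
rewrite diff_comp//= g0 -Gw [in RHS]derive_line -/g.
by congr ('d F _ _); rewrite deriveE.
Qed.

Lemma derive_near V W (f : V -> W) x v (e : R) : derivable f x v -> 0 < e ->
  \forall h \near (0 : R), `|f (h *: v + x) - f x - h *: 'D_v f x| <= e * `|h|.
Proof.
move=> df e0; have /eqaddoP/(_ _ e0) := derivable_nbhs df.
apply: filterS => h /=.
by rewrite opprD addrA.
Qed.

(** In a normed space only the inequality survives. It comes from a supremum: if
    the bound with slope C + eps holds up to c, the derivative at c carries it
    beyond c, so the largest such c is b. *)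
Lemma norm_increment_le W (g : R -> W) (C a b : R) : a <= b ->
  (forall t, a <= t <= b -> derivable g t 1) ->
  (forall t, a <= t <= b -> `|'D_1 g t| <= C) ->
  `|g b - g a| <= C * (b - a).
Proof.
move=> ab dg gC; apply/ler_addgt0Pr => e e0.
pose K := C + e / (b - a + 1).
have ba1 : 0 < b - a + 1 by lra.
have d0 : 0 < e / (b - a + 1) by rewrite divr_gt0.
suff : `|g b - g a| <= K * (b - a).
  move=> /le_trans; apply; rewrite /K mulrDl lerD2l.
  by rewrite mulrAC ler_pdivrMr// ler_pM2l//; lra.
have C0 : 0 <= C by apply: le_trans (gC a _); rewrite ?lexx.
pose A := [set t | a <= t <= b /\
   forall s, a <= s <= t -> `|g s - g a| <= K * (s - a)].
have Aa : A a.
  split; first by rewrite lexx.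
  move=> s /andP[sa sa']; have -> : s = a by apply: le_anti; rewrite sa sa'.
  by rewrite !subrr normr0 mulr0.
have hsA : has_sup A.
  by split; [exists a|exists b => t [/andP[]]].
have supA t : A t -> t <= sup A by exact: (sup_upper_bound hsA).
set c := sup A in supA.
have ac : a <= c by exact: supA.
have cb : c <= b by apply: ge_sup; [exists a|move=> t [/andP[]]].
have below s : a <= s -> s < c -> `|g s - g a| <= K * (s - a).
  move=> as_ sc; have e'0 : 0 < c - s by rewrite subr_gt0.
  have [t [_ At]] := sup_adherent e'0 hsA.
  by rewrite -/c subKr => st; apply: At; rewrite as_ ltW.
have K0 : 0 < K by rewrite /K; lra.
have [dl /= dl0 near_c] : exists2 dl, 0 < dl & forall h, `|h| < dl ->
    `|g (h + c) - g c| <= K * `|h|.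
  have acb : a <= c <= b by rewrite ac.
  have /nbhs_ballP[dl /= dl0 H] := derive_near (dg c acb) d0.
  exists dl => // h hdl.
  have := H h; rewrite -ball_normE /= sub0r normrN => /(_ hdl).
  have -> : h%:A = h :> R by rewrite [LHS]mulr1.
  move=> H1; rewrite -(subrK (h *: 'D_1 g c) (g _ - g c)).
  apply: le_trans (ler_normD _ _) _; rewrite /K mulrDl addrC lerD//.
  by rewrite normrZ mulrC ler_wpM2r// gC// ac.
have Ac : `|g c - g a| <= K * (c - a).
  have [->|ca] := eqVneq c a; first by rewrite !subrr normr0 mulr0.
  have {}ca : a < c by rewrite lt_neqAle eq_sym ca.
  pose h := Num.min (dl / 2) (c - a).
  have h0 : 0 < h by rewrite lt_min divr_gt0//= subr_gt0.
  have hd : h < dl.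
    by rewrite gt_min ltr_pdivrMr// ltr_pMr// ltr1n.
  have hc : h <= c - a by rewrite /h ge_min lexx orbT.
  have := near_c (- h); rewrite normrN gtr0_norm// => /(_ hd) H1.
  have H2 : `|g (c - h) - g a| <= K * (c - h - a) by apply: below; lra.
  rewrite -(subrKA (g (c - h))); apply: le_trans (ler_normD _ _) _.
  rewrite distrC [- h + c]addrC in H1.
  have -> : K * (c - a) = K * h + K * (c - h - a) by ring.
  exact: lerD.
have [<-//|bc] := eqVneq c b.
have {}bc : c < b by rewrite lt_neqAle bc.
pose h := Num.min (dl / 2) (b - c).
have h0 : 0 < h by rewrite lt_min divr_gt0//= subr_gt0.
have hd : h < dl.
  by rewrite gt_min ltr_pdivrMr// ltr_pMr// ltr1n.
have hc : h <= b - c by rewrite /h ge_min lexx orbT.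
suff : A (c + h) by move/supA; lra.
split; first by lra.
move=> s /andP[as_ sch]; have [/below|cs] := ltP s c; first exact.
have := near_c (s - c); rewrite subrK ger0_norm; last by lra.
have sd : s - c < dl by lra.
move=> /(_ sd) H1.
rewrite -(subrKA (g c)); apply: le_trans (ler_normD _ _) _.
have -> : K * (s - a) = K * (s - c) + K * (c - a) by ring.
exact: lerD.
Qed.

Lemma norm_increment_abs_le W (g : R -> W) (C a b : R) :
  (forall t, `|t - a| <= `|b - a| -> derivable g t 1) ->
  (forall t, `|t - a| <= `|b - a| -> `|'D_1 g t| <= C) ->
  `|g b - g a| <= C * `|b - a|.
Proof.
move=> dg gC; have [ab|ba] := leP a b.
  have ab0 : 0 <= b - a by rewrite subr_ge0.
  rewrite ger0_norm//; apply: norm_increment_le => // t /andP[at_ tb];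
    [apply: dg|apply: gC]; rewrite !ger0_norm ?subr_ge0//; lra.
have ab0 : 0 <= a - b by lra.
rewrite distrC [`|b - a|]distrC ger0_norm//.
apply: norm_increment_le => [|t /andP[bt ta]|t /andP[bt ta]]; first lra.
- by apply: dg; rewrite distrC [`|b - a|]distrC !ger0_norm//; lra.
- by apply: gC; rewrite distrC [`|b - a|]distrC !ger0_norm//; lra.
Qed.

Lemma is_derive_along_line V W (f : V -> W) z v (t : R) l :
  is_derive (t *: v + z) v f l -> is_derive t 1 (fun s : R => f (s *: v + z)) l.
Proof.
move=> [df <-].
have e : (fun h : R => h^-1 *:
    (((fun s : R => f (s *: v + z)) \o shift t) (h *: 1) - f (t *: v + z))) =
  (fun h : R => h^-1 *: ((f \o shift (t *: v + z)) (h *: v) - f (t *: v + z))).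
  by apply/funext => h /=; rewrite [_%:A]mulr1 scalerDl addrA.
by apply: DeriveDef; rewrite /derivable /derive /= e.
Qed.

(** First-order expansion along finitely many directions, from the continuity of
    the directional derivatives: move in one direction at a time and apply the
    mean value inequality to each step. *)
Lemma increment_sum V W (f : V -> W) x (I : Type) (e : I -> V) (r : seq I)
    (eps : R) : 0 < eps ->
  (forall i, \forall y \near x, derivable f y (e i)) ->
  (forall i, {for x, continuous ('D_(e i) f)}) ->
  exists2 dl : R, 0 < dl & forall c : I -> R, (forall i, `|c i| <= dl) ->
  `|f (\sum_(i <- r) c i *: e i + x) - f x - \sum_(i <- r) c i *: 'D_(e i) f x|
    <= eps * \sum_(i <- r) `|c i|.
Proof.
move=> eps0 df cDf; elim: r => [|i r [dl0 dl00 IH]].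
  by exists 1 => // c _; rewrite !big_nil add0r !subrr normr0 mulr0.
have: \forall y \near x, derivable f y (e i) /\
    `|'D_(e i) f x - 'D_(e i) f y| <= eps.
  by apply: filterI; [exact: df|apply: cvgr_dist_le (cDf i) _ eps0].
move=> /nbhs_ballP[rho /= rho0 near_x].
pose E := \sum_(j <- i :: r) `|e j|.
have E0 : 0 <= E by apply: sumr_ge0.
have E1 : 0 < 1 + E by lra.
have dl0' : 0 < rho / (1 + E) by rewrite divr_gt0.
exists (Num.min dl0 (rho / (1 + E))); first by rewrite lt_min dl00.
move=> c cdl.
have c1 j : `|c j| <= dl0 by apply: le_trans (cdl j) _; rewrite ge_min lexx.
have c2 j : `|c j| <= rho / (1 + E).
  by apply: le_trans (cdl j) _; rewrite ge_min lexx orbT.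
have {IH}IH := IH c c1.
set z0 := \sum_(j <- r) c j *: e j + x in IH.
have in_ball (s : R) : `|s| <= `|c i| -> ball x rho (s *: e i + z0).
  move=> sc; rewrite -ball_normE /= distrC /z0 addrA addrK.
  apply: (@le_lt_trans _ _ (rho / (1 + E) * E)).
    apply: le_trans (ler_normD _ _) _.
    rewrite [X in _ <= _ * X]big_cons mulrDr lerD//.
      by rewrite normrZ; apply: ler_wpM2r => //; exact: le_trans sc (c2 i).
    apply: le_trans (ler_norm_sum _ _ _) _.
    rewrite mulr_sumr; apply: ler_sum => j _.
    by rewrite normrZ; apply: ler_wpM2r.
  by rewrite mulrAC ltr_pdivrMr// ltr_pM2l//; lra.
pose D := 'D_(e i) f x.
pose g (s : R) := f (s *: e i + z0) - s *: D.
have dg (t : R) : `|t| <= `|c i| ->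
    is_derive t 1 g ('D_(e i) f (t *: e i + z0) - D).
  move=> tc; have [d1 _] := near_x _ (in_ball _ tc).
  apply: is_deriveB.
    by apply: is_derive_along_line; exact: DeriveDef.
  apply: is_derive_cvg; apply: cvg_near_cst; near=> h.
  rewrite /= -scalerBl addrK scalerA [_%:A]mulr1 mulVf ?scale1r//.
  by near: h; exact: nbhs_dnbhs_neq.
have H : `|g (c i) - g 0| <= eps * `|c i - 0|.
  apply: norm_increment_abs_le => t; rewrite !subr0 => tc.
    by case: (dg t tc).
  have [_ ->] := dg t tc.
  by have [_] := near_x _ (in_ball _ tc); rewrite distrC.
rewrite /g scale0r add0r scale0r !subr0 in H.
rewrite !big_cons mulrDr opprD.
have -> : c i *: e i + \sum_(j <- r) c j *: e j + x = c i *: e i + z0.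
  by rewrite /z0 addrA.
have -> : f (c i *: e i + z0) - f x +
   (- (c i *: 'D_(e i) f x) - \sum_(j <- r) c j *: 'D_(e j) f x) =
   (f (c i *: e i + z0) - c i *: D - f z0) +
   (f z0 - f x - \sum_(j <- r) c j *: 'D_(e j) f x).
  by rewrite /D [RHS]addrA subrKA [LHS]addrA; congr (_ + _); rewrite addrAC.
exact: le_trans (ler_normD _ _) (lerD H IH).
Unshelve. all: by end_near. Qed.

Lemma ler_mx_entry m n (h : 'M[R]_(m, n)) i j : `|h i j| <= `|h|.
Proof.
by rewrite [leRHS]/Num.Def.normr/= mx_normrE; exact: (le_bigmax _ _ (i, j)).
Qed.

Lemma linear_mx_continuous m n W (L : {linear 'M[R]_(m, n) -> W}) :
  continuous L.
Proof.
pose K : R := \sum_i \sum_j `|L (delta_mx i j)|.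
have LK h : `|L h| <= K * `|h|.
  rewrite [in leLHS](matrix_sum_delta h) linear_sum /K mulr_suml.
  apply: le_trans (ler_norm_sum _ _ _) _; apply: ler_sum => i _.
  rewrite linear_sum mulr_suml.
  apply: le_trans (ler_norm_sum _ _ _) _; apply: ler_sum => j _.
  by rewrite linearZ/= normrZ mulrC ler_wpM2l// ler_mx_entry.
have K0 : 0 <= K by do 2 apply: sumr_ge0 => ? _.
move=> y; apply/(@cvgrPdist_lt _ _ _ (nbhs y)) => eps eps0.
have K1 : 0 < K + 1 by lra.
near=> z; rewrite -linearB.
apply: le_lt_trans (LK _) _.
apply: (@le_lt_trans _ _ ((K + 1) * `|y - z|)).
  by rewrite ler_wpM2r//; lra.
rewrite -ltr_pdivlMl// mulrC.
near: z; apply/nbhs_ballP; exists (eps / (K + 1)); first exact: divr_gt0.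
by move=> z; rewrite -ball_normE.
Unshelve. all: by end_near. Qed.

(** The passage from directional derivatives, in which C^k is phrased, to the
    differential, which has a chain rule. The expansion along the elementary
    matrices is linear in the increment with an error o(h). *)
Lemma C1_differentiable_mx m n W (f : 'M[R]_(m, n) -> W) x :
  (forall v, \forall y \near x, derivable f y v) ->
  (forall v, {for x, continuous ('D_v f)}) -> differentiable f x.
Proof.
move=> df cDf.
pose e (p : 'I_m * 'I_n) : 'M[R]_(m, n) := delta_mx p.1 p.2.
pose L (h : 'M[R]_(m, n)) : W :=
  \sum_(p <- enum {: 'I_m * 'I_n}) h p.1 p.2 *: 'D_(e p) f x.
have L_linear : linear L.
  move=> a u v; rewrite /L scaler_sumr -big_split /=.
  by apply: eq_bigr => p _; rewrite !mxE scalerDl scalerA.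
pose LM := GRing.isLinear.Build _ _ _ _ _ L_linear.
pose LL : {linear 'M[R]_(m, n) -> W} := HB.pack L LM.
have hE (h : 'M[R]_(m, n)) :
    h = \sum_(p <- enum {: 'I_m * 'I_n}) h p.1 p.2 *: e p.
  rewrite big_enum /= [LHS]matrix_sum_delta pair_big /=.
  by apply: eq_bigr.
have L_cont : continuous LL by exact: linear_mx_continuous.
have fE : f \o shift x = cst (f x) + LL +o_ 0 id.
  apply/eqaddoP => eps eps0.
  pose N : R := \sum_(p <- enum {: 'I_m * 'I_n}) 1.
  have N0 : 0 <= N by apply: sumr_ge0.
  have N1 : 0 < N + 1 by lra.
  have eps' : 0 < eps / (N + 1) by rewrite divr_gt0.
  have [dl dl0 H] := @increment_sum _ _ f x _ e (enum {: 'I_m * 'I_n}) _ eps'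
    (fun p => df (e p)) (fun p => cDf (e p)).
  near=> h.
  have hdl : `|h| <= dl.
    near: h; apply/nbhs_ballP; exists dl => // z.
    by rewrite -ball_normE /= sub0r normrN => /ltW.
  have := H (fun p => h p.1 p.2) (fun p =>
    le_trans (ler_mx_entry h p.1 p.2) hdl).
  rewrite -hE -/(L h) => {}H /=.
  rewrite -[X in `|X|]/(f (h + x) - (f x + L h)) opprD addrA.
  apply: le_trans H _; rewrite mulrAC ler_pdivrMr// -mulrA ler_pM2l//.
  apply: (@le_trans _ _ (`|h| * N)).
    rewrite /N mulr_sumr; apply: ler_sum => p _; rewrite mulr1;
      exact: ler_mx_entry.
  by rewrite ler_wpM2l//; lra.
have dfE := diff_unique L_cont fE.
by apply/diff_locallyP; rewrite dfE.
Unshelve. all: by end_near. Qed.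

Lemma diff_mxE m n W (f : 'M[R]_(m, n) -> W) x h : differentiable f x ->
  'd f x h = \sum_i \sum_j h i j *: 'D_(delta_mx i j) f x.
Proof.
move=> df; rewrite [in LHS](matrix_sum_delta h) linear_sum.
apply: eq_bigr => i _; rewrite linear_sum; apply: eq_bigr => j _.
by rewrite linearZ deriveE.
Qed.

Lemma is_derive_scale V W (a : V -> R) (b : V -> W) x v da db :
  is_derive x v a da -> is_derive x v b db ->
  is_derive x v (fun y => a y *: b y) (a x *: db + da *: b x).
Proof.
move=> [a' <-] [b' <-]; apply: is_derive_cvg.
have -> : (fun h : R => h^-1 *: (((fun y => a y *: b y) \o shift x) (h *: v)
      - a x *: b x)) =
  (fun h : R => a (h *: v + x) *: (h^-1 *: (b (h *: v + x) - b x)) +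
     (h^-1 *: (a (h *: v + x) - a x)) *: b x).
  apply/funext => h /=.
  rewrite -[X in _ + X *: _]/(h^-1 * (a (h *: v + x) - a x)).
  rewrite scalerA [a _ * _]mulrC -!scalerA -scalerDr.
  by congr (_ *: _); rewrite scalerBr scalerBl addrA subrK.
apply: cvgD; last by apply: cvgZr_tmp; exact: a'.
apply: cvgZ; last exact: b'.
suff : {for 0, continuous (fun h : R => a (h *: v + x))}.
  by move=> /continuous_withinNx; rewrite scale0r add0r.
exact/differentiable_continuous/derivable1_diffP/(derivable1P _ _ _).1.
Qed.

Lemma is_derive_sum_seq V W (I : Type) (r : seq I) (h : I -> V ->
  W) (dh : I -> W) x v :
  (forall i, is_derive x v (h i) (dh i)) ->
  is_derive x v (fun y => \sum_(i <- r) h i y) (\sum_(i <- r) dh i).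
Proof.
move=> hdh; elim: r => [|i r IH].
  rewrite big_nil; have -> : (fun y => \sum_(i <- [::]) h i y) = cst 0.
    by apply/funext => y; rewrite big_nil.
  exact: is_derive_cst.
rewrite big_cons; have -> : (fun y => \sum_(j <- i :: r) h j y) =
    (h i \+ (fun y => \sum_(j <- r) h j y)).
  by apply/funext => y; rewrite big_cons.
exact: is_deriveD.
Qed.

Lemma is_derive_mx V m n (F : V -> 'M[R]_(m, n))
    (D : 'M[R]_(m, n)) x v :
  (forall i j, is_derive x v (fun y => F y i j) (D i j)) -> is_derive x v F D.
Proof.
move=> FD; have dF : derivable F x v.
  by apply/derivable_mxP => i j; case: (FD i j).
apply: DeriveDef => //; rewrite derive_mx//; apply/matrixP => i j; rewrite mxE.
by case: (FD i j).
Qed.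

End Calculus.

(** * Calculus of C^k maps *)

Section Ck_theory.
Context {R : realType}.
Implicit Types V W : normedModType R.

Lemma Ck_continuous V W k (U : set V) (f : V -> W) x :
  Ck k U f -> U x -> {for x, continuous f}.
Proof. by case: k => [|k] [cf _] Ux; exact: cf. Qed.

Lemma Ck_derivable V W k (U : set V) (f : V -> W) x v :
  Ck k.+1 U f -> U x -> derivable f x v.
Proof. by move=> [_ /(_ v)[df _]] Ux; exact: df. Qed.

Lemma Ck_derive V W k (U : set V) (f : V -> W) v :
  Ck k.+1 U f -> Ck k U ('D_v f).
Proof. by move=> [_ /(_ v)[]]. Qed.

Lemma Ck_is_derive V W k (U : set V) (f : V -> W) x v :
  Ck k.+1 U f -> U x -> is_derive x v f ('D_v f x).
Proof. by move=> fk Ux; apply: DeriveDef => //; exact: Ck_derivable fk Ux. Qed.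

Lemma CkS V W k (U : set V) (f : V -> W) : Ck k.+1 U f -> Ck k U f.
Proof.
elim: k f => [|k IH] f fk.
  by split=> // x Ux; exact: Ck_continuous fk Ux.
split=> [x Ux|v]; first exact: Ck_continuous fk Ux.
split=> [x Ux|]; first exact: Ck_derivable fk Ux.
exact/IH/Ck_derive.
Qed.

Lemma Ck_subset V W k (U U' : set V) (f : V -> W) :
  U' `<=` U -> Ck k U f -> Ck k U' f.
Proof.
move=> UU'; elim: k f => [|k IH] f [cf df]; split => //.
- by move=> x /UU'; exact: cf.
- by move=> x /UU'; exact: cf.
- move=> v; have [d1 d2] := df v; split; first by move=> x /UU'; exact: d1.
  exact: IH.
Qed.

Lemma near_open_eq V W (U : set V) (f g : V -> W) x :
  open U -> (forall y, U y -> f y = g y) -> U x -> \forall y \near x, f y = g y.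
Proof.
move=> oU fg Ux; have : nbhs x U by exact: open_nbhs_nbhs.
by apply: filterS => y; exact: fg.
Qed.

Lemma near_continuous (S : topologicalType) W (f g : S -> W) x :
  (\forall y \near x, f y = g y) ->
  {for x, continuous f} -> {for x, continuous g}.
Proof.
move=> fg cf; rewrite /prop_for /continuous_at -(nbhs_singleton fg).
by apply: cvg_trans cf; apply: near_eq_cvg.
Qed.

(** Openness matters: the derivatives at a point of U see a neighbourhood of it. *)
Lemma Ck_eq V W k (U : set V) (f g : V -> W) : open U ->
  (forall y, U y -> f y = g y) -> Ck k U f -> Ck k U g.
Proof.
move=> oU; elim: k f g => [|k IH] f g fg [cf df]; split => //.
- by move=> x Ux; apply: near_continuous (cf x Ux);
  exact: near_open_eq oU fg Ux.
- by move=> x Ux; apply: near_continuous (cf x Ux);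
  exact: near_open_eq oU fg Ux.
- move=> v; have [d1 d2] := df v; split.
    move=> x Ux; apply: near_eq_derivable (d1 x Ux).
    exact: near_open_eq oU fg Ux.
  apply: IH d2 => x Ux; apply: near_eq_derive.
  exact: near_open_eq oU fg Ux.
Qed.

(** The induction step of all closure properties below: a formula for the
    derivative is C^k, hence the map is C^(k+1). *)
Lemma Ck_is_deriveP V W k (U : set V) (f : V -> W) (df : V -> V -> W) :
  open U -> (forall x, U x -> {for x, continuous f}) ->
  (forall x v, U x -> is_derive x v f (df v x)) ->
  (forall v, Ck k U (df v)) -> Ck k.+1 U f.
Proof.
move=> oU cf fdf dfk; split => // v; split.
  by move=> x Ux; case: (fdf x v Ux).
by apply: Ck_eq (dfk v) => // x Ux; case: (fdf x v Ux).
Qed.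

Lemma Ck_cst V W k (U : set V) (a : W) : Ck k U (fun=> a).
Proof.
have h x : {for x, continuous (fun _ : V => a)} by exact: cst_continuous.
elim: k a h => [|k IH] a h; split => // v; split.
  by move=> x _; exact: derivable_cst.
have -> : 'D_v (fun=> a) = fun=> 0 :> W by apply/funext => x; exact: derive_cst.
by apply: IH => x; exact: cst_continuous.
Qed.

Lemma CkD V W k (U : set V) (f g : V -> W) : open U ->
  Ck k U f -> Ck k U g -> Ck k U (fun x => f x + g x).
Proof.
move=> oU; elim: k f g => [|k IH] f g fk gk.
  split=> // x Ux; apply: cvgD; [exact: fk.1|exact: gk.1].
apply: (@Ck_is_deriveP _ _ _ _ _ (fun v x => 'D_v f x + 'D_v g x)) => //.
- by move=> x Ux; apply: cvgD; [exact: fk.1|exact: gk.1].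
- by move=> x v Ux; apply: is_deriveD;
  [exact: Ck_is_derive fk Ux|exact: Ck_is_derive gk Ux].
- by move=> v; apply: IH; exact: Ck_derive.
Qed.

Lemma Ck_sum V W k (U : set V) (I : Type) (r : seq I) (f : I -> V -> W) :
  open U -> (forall i, Ck k U (f i)) -> Ck k U (fun x => \sum_(i <- r) f i x).
Proof.
move=> oU fk; elim: r => [|i r IH].
  by apply: Ck_eq (Ck_cst _ _ 0) => // x _; rewrite big_nil.
by apply: Ck_eq (CkD oU (fk i) IH) => // x _; rewrite big_cons.
Qed.

Lemma CkZ V W k (U : set V) (a : V -> R) (f : V -> W) : open U ->
  Ck k U a -> Ck k U f -> Ck k U (fun x => a x *: f x).
Proof.
move=> oU; elim: k a f => [|k IH] a f ak fk.
  split=> // x Ux; apply: cvgZ; [exact: ak.1|exact: fk.1].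
apply: (@Ck_is_deriveP _ _ _ _ _ (fun v x =>
  a x *: 'D_v f x + 'D_v a x *: f x)) => //.
- by move=> x Ux; apply: cvgZ; [exact: ak.1|exact: fk.1].
- move=> x v Ux; apply: is_derive_scale;
    [exact: Ck_is_derive ak Ux|exact: Ck_is_derive fk Ux].
- move=> v; apply: CkD => //; apply: IH => //;
   by [exact: Ck_derive|exact: CkS].
Qed.

Lemma Ck_linear_comp V W (X : normedModType R) k (U : set V) (f : V -> W)
    (L : {linear W -> X}) : open U -> continuous L ->
  Ck k U f -> Ck k U (fun x => L (f x)).
Proof.
move=> oU cL; elim: k f => [|k IH] f fk.
  split=> // x Ux; apply: (@continuous_comp _ _ _ f L); first exact: fk.1.
  exact: cL.
apply: (@Ck_is_deriveP _ _ _ _ _ (fun v x => L ('D_v f x))) => //.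
- move=> x Ux; apply: (@continuous_comp _ _ _ f L); first exact: fk.1.
  exact: cL.
- move=> x v Ux; have dL : differentiable L (f x)
  by exact: linear_differentiable.
  have := is_derive_comp dL (Ck_is_derive v fk Ux).
  by rewrite (diff_lin (f x) cL).
- by move=> v; apply: IH; exact: Ck_derive.
Qed.

Lemma Ck_entry V k (U : set V) m n (f : V -> 'M[R]_(m, n)) i j : open U ->
  Ck k U f -> Ck k U (fun x => f x i j).
Proof.
move=> oU fk.
have L_linear : linear (fun M : 'M[R]_(m, n) => M i j : R).
  by move=> a u v; rewrite !mxE.
pose LM := GRing.isLinear.Build _ _ _ _ _ L_linear.
pose L : {linear 'M[R]_(m, n) ->
  R} := HB.pack (fun M : 'M[R]_(m, n) => M i j : R) LM.
exact: (Ck_linear_comp oU (@linear_mx_continuous _ _ _ _ L) fk).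
Qed.

Lemma Ck_mx V k (U : set V) m n (f : V -> 'M[R]_(m, n)) : open U ->
  (forall i j, Ck k U (fun x => f x i j)) -> Ck k U f.
Proof.
move=> oU fk; apply: (@Ck_eq _ _ _ _
    (fun x => \sum_i \sum_j f x i j *: (delta_mx i j : 'M[R]_(m, n)))) => //.
  by move=> x _; rewrite -matrix_sum_delta.
do 2 apply: Ck_sum => // ?.
by apply: CkZ => //; exact: Ck_cst.
Qed.

Lemma Ck_differentiable m n W k (U : set 'M[R]_(m, n)) (f : 'M[R]_(m, n) ->
  W) x :
  open U -> Ck k.+1 U f -> U x -> differentiable f x.
Proof.
move=> oU fk Ux; apply: C1_differentiable_mx => v.
  have : nbhs x U by exact: open_nbhs_nbhs.
  by apply: filterS => y Uy; exact: Ck_derivable fk Uy.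
exact: Ck_continuous (Ck_derive v fk) Ux.
Qed.

(** The derivative of the composite is a sum of entries of the derivative of f
    times partial derivatives of g composed with f; these are C^k by induction. *)
Lemma Ck_comp V m n W k (U : set V) (U' : set 'M[R]_(m, n))
    (f : V -> 'M[R]_(m, n)) (g : 'M[R]_(m, n) -> W) : open U -> open U' ->
  (forall x, U x -> U' (f x)) ->
  Ck k U f -> Ck k U' g -> Ck k U (g \o f).
Proof.
move=> oU oU' UU'; elim: k g => [|k IH] g fk gk.
  split=> // x Ux; apply: continuous_comp; first exact: fk.1.
  exact/gk.1/UU'.
apply: (@Ck_is_deriveP _ _ _ _ _ (fun v x =>
    \sum_i \sum_j 'D_v f x i j *: 'D_(delta_mx i j) g (f x))) => //.
- move=> x Ux; apply: continuous_comp; first exact: fk.1.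
  exact/gk.1/UU'.
- move=> x v Ux.
  have dg : differentiable g (f x) by apply: Ck_differentiable gk _ => //;
    exact: UU'.
  rewrite -(diff_mxE _ dg).
  by apply: is_derive_comp => //; exact: Ck_is_derive fk Ux.
- move=> v; apply: Ck_sum => // i; apply: Ck_sum => // j; apply: CkZ => //.
    by apply: Ck_entry => //; exact: Ck_derive.
  exact: (IH ('D_(delta_mx i j) g) (CkS fk) (Ck_derive _ gk)).
Qed.

Lemma Ck_id V k (U : set V) : Ck k U (fun x : V => x).
Proof.
case: k => [|k]; split => //; try by move=> x _; exact: cvg_id.
move=> v; split; first by move=> x _; exact: derivable_id.
have -> : 'D_v (fun x : V => x) = fun=> v by apply/funext => x;
  exact: derive_id.
exact: Ck_cst.
Qed.

Lemma Ck_linear_mx V k (U : set V) m1 n1 m2 n2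
    (L : {linear 'M[R]_(m1, n1) -> 'M[R]_(m2, n2)}) (u : V -> 'M[R]_(m1, n1)) :
  open U -> Ck k U u -> Ck k U (fun s => L (u s)).
Proof. by move=> oU; apply: Ck_linear_comp => //;
  exact: linear_mx_continuous. Qed.

Lemma Ck_col_mx V k (U : set V) m1 m2 l
    (u : V -> 'M[R]_(m1, l)) (v : V -> 'M[R]_(m2, l)) : open U ->
  Ck k U u -> Ck k U v -> Ck k U (fun s => col_mx (u s) (v s)).
Proof.
move=> oU uk vk; apply: Ck_mx => // i j.
case: (split_ordP i) => i' ->.
  by apply: Ck_eq (Ck_entry i' j oU uk) => // s _; rewrite col_mxEu.
by apply: Ck_eq (Ck_entry i' j oU vk) => // s _; rewrite col_mxEd.
Qed.

Lemma is_derive_linear_mx m1 n1 m2 n2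
    (L : {linear 'M[R]_(m1, n1) -> 'M[R]_(m2, n2)}) (u : R -> 'M[R]_(m1, n1)) (t : R) du :
  is_derive t 1 u du -> is_derive t 1 (fun s => L (u s)) (L du).
Proof.
move=> dudt; have cL := @linear_mx_continuous _ _ _ _ L.
have dL : differentiable L (u t) by exact: linear_differentiable.
by have := is_derive_comp dL dudt; rewrite (diff_lin (u t) cL).
Qed.

Lemma open_norm_lt (a : R) : open [set t : R | `|t| < a].
Proof.
by apply: (@open_comp _ _ (fun t : R => `|t|) [set r | r < a]) => [t _|];
  [exact: norm_continuous|exact: open_lt].
Qed.

End Ck_theory.

(** * Ordinary differential equations *)

Section Antiderivatives.
Context {R : realType}.

(** Integration enters the development here only: everything else about
    antiderivatives follows from the mean value inequality. *)
Lemma antiderivative_real (g : R -> R) (l : R) : continuous g ->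
  exists G : R -> R, forall t, l < t -> is_derive t 1 G (g t).
Proof.
move=> cg; pose mu := @lebesgue_measure R.
exists (fun x => \int[mu]_(t in `[l, x]) g t)%R => t lt.
have tt1 : t < t + 1 by rewrite ltrDl.
have gint : mu.-integrable `[l, t + 1] (EFin \o g).
  apply: continuous_compact_integrable; first exact: segment_compact.
  exact: continuous_subspaceT.
have [dG GE] := continuous_FTC1_closed tt1 gint lt (cg t).
by apply: (DeriveDef dG); rewrite -GE derive1E.
Qed.

Lemma antiderivative m n (g : R -> 'M[R]_(m, n)) (l : R) : continuous g ->
  exists G : R -> 'M[R]_(m, n), forall t, l < t -> is_derive t 1 G (g t).
Proof.
move=> cg.
have /choice[G Gg] (ij : 'I_m * 'I_n) : exists G : R -> R,
    forall t, l < t -> is_derive t 1 G (g t ij.1 ij.2).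
  apply: antiderivative_real => t.
  by apply: (@continuous_comp _ _ _ g (fun M : 'M[R]_(m, n) => M ij.1 ij.2));
    [exact: cg|exact: coord_continuous].
exists (fun t => \matrix_(i, j) G (i, j) t) => t lt.
have entry i j : (fun x => (\matrix_(i0, j0) G (i0, j0) x) i j) = G (i, j).
  by apply/funext => x; rewrite mxE.
have dG : derivable (fun t => \matrix_(i, j) G (i, j) t) t 1.
  by apply/derivable_mxP => i j; rewrite entry; case: (Gg (i, j) t lt).
apply: DeriveDef => //; rewrite derive_mx//; apply/matrixP => i j.
by rewrite mxE entry; case: (Gg (i, j) t lt).
Qed.

Lemma le_geometric (A B C : R) :
  (forall k, A <= B + C * (2^-1) ^+ k) -> A <= B.
Proof.
move=> ABC.
have h : (fun k : nat => B + C * (2^-1) ^+ k) @ \oo --> B + C * 0.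
  apply: cvgD; first exact: cvg_cst.
  apply: cvgMl_tmp; apply: cvg_expr; rewrite ger0_norm; lra.
rewrite mulr0 addr0 in h.
by apply: cvgr_to_ge h _; apply: nearW => k; exact: ABC.
Qed.

Lemma geometric_cauchy_cvg m n (u : nat -> 'M[R]_(m, n)) (C : R) :
  (forall k, `|u k.+1 - u k| <= C * (2^-1) ^+ k) ->
  exists l, forall k, `|l - u k| <= 2 * C * (2^-1) ^+ k.
Proof.
move=> uC.
have C0 : 0 <= C by have := uC 0; rewrite expr0 mulr1; exact: le_trans.
have tele k p : `|u (k + p)%N - u k| <= 2 * C * (2^-1) ^+ k * (1 - (2^-1) ^+ p).
  elim: p => [|p IH]; first by rewrite addn0 !subrr normr0 mulr0.
  rewrite addnS -(subrKA (u (k + p)%N)).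
  apply: le_trans (ler_normD _ _) _; apply: le_trans (lerD (uC _) IH) _.
  have -> : 2 * C * (2^-1) ^+ k * (1 - (2^-1) ^+ p.+1) =
    C * (2^-1) ^+ (k + p) + 2 * C * (2^-1) ^+ k * (1 - (2^-1) ^+ p).
    by rewrite exprS exprD; field.
  exact: lexx.
have half_ge0 k : 0 <= (2^-1 : R) ^+ k by apply: exprn_ge0; lra.
have tele' k j : (k <= j)%N -> `|u j - u k| <= 2 * C * (2^-1) ^+ k.
  move=> kj; rewrite -(subnKC kj); apply: le_trans (tele _ _) _.
  by apply: ler_piMr; [rewrite !mulr_ge0|rewrite lerBlDr lerDl].
have ucvg : cvg (u @ \oo).
  apply: cauchy_cvg; apply: cauchy_exP => e e0.
  have [N HN] : exists N, 2 * C * (2^-1) ^+ N < e.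
    apply: contrapT => /forallNP H.
    have : e <= 0.
      apply: (@le_geometric _ _ (2 * C)) => k; rewrite add0r leNgt.
      exact/negP/H.
    by rewrite leNgt e0.
  exists (u N), N => // j /= Nj.
  by rewrite -ball_normE /= distrC; apply: le_lt_trans (tele' _ _ Nj) HN.
exists (lim (u @ \oo)) => k.
have h : (fun j => `|u j - u k|) @ \oo --> `|lim (u @ \oo) - u k|.
  by apply: cvg_norm; apply: cvgB => //; exact: cvg_cst.
apply: cvgr_to_le h _; exists k => // j /= kj; exact: tele'.
Qed.

End Antiderivatives.

Section Picard.
Context {R : realType} {m n : nat}.
Local Notation V := 'M[R]_(m, n).

Lemma lipschitz_continuous (g : R -> V) (K : R) :
  (forall t s, `|g t - g s| <= K * `|t - s|) -> continuous g.
Proof.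
move=> gK t; apply/cvgrPdist_lt => e e0.
have K1 : 0 < `|K| + 1 by rewrite ltr_wpDl.
near=> s; apply: le_lt_trans (gK t s) _.
apply: (@le_lt_trans _ _ ((`|K| + 1) * `|t - s|)).
  by rewrite ler_wpM2r// (le_trans (ler_norm _))// lerDl.
rewrite -ltr_pdivlMl// mulrC.
near: s; apply/nbhs_ballP; exists (e / (`|K| + 1)); first exact: divr_gt0.
by move=> z.
Unshelve. all: by end_near. Qed.

(** The operator T x = x0 + integral of F o x maps K-Lipschitz curves in the ball
    to such curves since a K <= r, and halves uniform distances since
    a L <= 1/2. Its iterates therefore converge uniformly, and the limit is a
    fixed point. *)
Theorem picard (F : V -> V) (x0 : V) (a r L K : R) :
  0 < a -> 0 <= r -> 0 <= L ->
  (forall x, `|x - x0| <= r -> `|F x| <= K) ->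
  (forall x y, `|x - x0| <= r -> `|y - x0| <= r ->
    `|F x - F y| <= L * `|x - y|) ->
  a * L <= 2^-1 -> a * K <= r ->
  exists x : R -> V, [/\ x 0 = x0, forall t, `|x t - x0| <= r &
    forall t : R, `|t| < a -> is_derive t 1 x (F (x t))].
Proof.
move=> a0 r0 L0 FK FL aL aK.
have K0 : 0 <= K by apply: le_trans (FK x0 _) => //; rewrite subrr normr0.
pose S := [set x : R -> V | (forall t, `|x t - x0| <= r) /\
                            (forall t s, `|x t - x s| <= K * `|t - s|)].
have FS x : S x -> continuous (F \o x).
  move=> [xr xK]; apply: (@lipschitz_continuous _ (L * K)) => t s /=.
  by apply: le_trans (FL _ _ (xr t) (xr s)) _; rewrite -mulrA ler_wpM2l.
(* The base point - 4 a lies to the left of all times |t - b| <= |c - b|, with b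
   and c in [-a, a], on which the mean value inequality is used below. *)
have /choice[P PP] (g : R -> V) : exists G : R -> V, continuous g ->
    forall t : R, - (4 * a) < t -> is_derive t 1 G (g t).
  have [cg|ncg] := pselect (continuous g); last by exists (fun=> 0).
  by have [G Gg] := antiderivative (- (4 * a)) cg; exists G.
(* Clamping time to [-a, a] makes the iterates Lipschitz on the whole line. *)
pose tau (t : R) := Num.max (- a) (Num.min a t).
have tau_a t : `|tau t| <= a.
  by rewrite ler_norml /tau le_max lexx/= ge_max ge_min lexx/= andbT; lra.
have tau_lip t s : `|tau t - tau s| <= `|t - s|.
  have min_lip (u v : R) : `|Num.min a u - Num.min a v| <= `|u - v|.
    have := ler_norm (u - v); have := ler_norm (v - u); rewrite distrC.
    by move: `|u - v| => d; rewrite ler_norml;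
      case: (leP a u) => ?; case: (leP a v) => ?; lra.
  have max_lip (u v : R) : `|Num.max (- a) u - Num.max (- a) v| <= `|u - v|.
    have := ler_norm (u - v); have := ler_norm (v - u); rewrite distrC.
    by move: `|u - v| => d; rewrite ler_norml;
      case: (leP (- a) u) => ?; case: (leP (- a) v) => ?; lra.
  exact: le_trans (max_lip _ _) (min_lip _ _).
have tau_id t : `|t| <= a -> tau t = t.
  rewrite ler_norml => /andP[? ?]; rewrite /tau min_r// max_r//.
have tau0 : tau 0 = 0 by apply: tau_id; rewrite normr0 ltW.
have in_dom (b c t : R) : `|b| <= a -> `|c| <= a -> `|t - b| <= `|c - b| ->
    - (4 * a) < t.
  move=> ba ca tb; have := le_trans tb (ler_normB c b).
  have := ba; rewrite ler_norml => /andP[ba' _].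
  by rewrite ler_norml => /andP[tb' _]; lra.
have norm0a : `|0 : R| <= a by rewrite normr0 ltW.
pose T (x : R -> V) : R -> V := fun t =>
  x0 + (P (F \o x) (tau t) - P (F \o x) 0).
have TS x : S x -> S (T x).
  move=> Sx; have [xr xK] := Sx; have Px := PP _ (FS x Sx).
  have inc (b c : R) : `|b| <= a -> `|c| <= a ->
      `|P (F \o x) c - P (F \o x) b| <= K * `|c - b|.
    move=> ba ca; apply: norm_increment_abs_le => t tb.
      by case: (Px t (in_dom _ _ _ ba ca tb)).
    by case: (Px t (in_dom _ _ _ ba ca tb)) => _ ->; apply: FK; exact: xr.
  split=> [t|t s].
    rewrite /T addrC addKr; apply: le_trans (inc _ _ _ _) _ => //.
    rewrite subr0; apply: le_trans aK; rewrite mulrC.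
    exact: ler_wpM2r.
  rewrite /T opprD addrACA subrr add0r opprB addrA subrK.
  by apply: le_trans (inc _ _ _ _) _ => //; rewrite ler_wpM2l.
have Tcontr x y (D : R) : S x -> S y -> (forall t, `|x t - y t| <= D) ->
    forall t, `|T x t - T y t| <= D / 2.
  move=> Sx Sy xyD t; have [xr xK] := Sx; have [yr yK] := Sy.
  have D0 : 0 <= D by apply: le_trans (xyD 0).
  have Px := PP _ (FS x Sx); have Py := PP _ (FS y Sy).
  pose G (t : R) := P (F \o x) t - P (F \o y) t.
  have dG (s : R) : - (4 * a) < s -> is_derive s 1 G (F (x s) - F (y s)).
    by move=> sa; apply: is_deriveB; [exact: Px|exact: Py].
  have -> : T x t - T y t = G (tau t) - G 0.
    rewrite /T /G opprD addrACA subrr add0r !opprB -!addrA; congr (_ + _).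
    by rewrite addrCA [RHS]addrCA; congr (_ + _); rewrite addrC.
  apply: (@le_trans _ _ (L * D * `|tau t - 0|)).
    apply: norm_increment_abs_le => s sb.
      by case: (dG s (in_dom _ _ _ norm0a (tau_a t) sb)).
    case: (dG s (in_dom _ _ _ norm0a (tau_a t) sb)) => _ ->.
    by apply: le_trans (FL _ _ (xr s) (yr s)) _; rewrite ler_wpM2l.
  rewrite subr0; apply: (@le_trans _ _ (L * D * a)).
    by rewrite ler_wpM2l// mulr_ge0.
  have -> : L * D * a = D * (a * L) by ring.
  exact: ler_wpM2l.
pose u k := iter k T (fun=> x0).
have uS k : S (u k).
  elim: k => [|k IH]; last exact: TS.
  by split=> [t|t s]; rewrite /u /= subrr normr0// mulr_ge0.
have u_contr k t : `|u k.+1 t - u k t| <= r * (2^-1) ^+ k.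
  elim: k t => [|k IH] t; first by rewrite expr0 mulr1; exact: (uS 1%N).1.
  by rewrite exprSr mulrA; exact: (Tcontr _ _ _ (uS k.+1) (uS k) IH).
have /choice[x xP] (t : R) : exists l : V, forall k,
    `|l - u k t| <= 2 * r * (2^-1) ^+ k.
  apply: (@geometric_cauchy_cvg _ _ _ (fun k => u k t)) => k; exact: u_contr.
have Sx : S x.
  split=> [t|t s].
    apply: (@le_geometric _ _ _ (2 * r)) => k.
    rewrite -(subrKA (u k t)) addrC; apply: le_trans (ler_normD _ _) _.
    by apply: lerD => //; exact: (uS k).1.
  apply: (@le_geometric _ _ _ (4 * r)) => k.
  have -> : x t - x s = (u k t - u k s) + ((x t - u k t) - (x s - u k s)).
    by rewrite opprB addrACA [u k t + _]addrC subrK addKr.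
  apply: le_trans (ler_normD _ _) _; apply: lerD; first exact: (uS k).2.
  apply: le_trans (ler_normB _ _) _; apply: le_trans (lerD (xP t k) (xP s k)) _.
  by rewrite -mulrDl ler_wpM2r ?exprn_ge0//; lra.
have Tx t : T x t = x t.
  apply/eqP; rewrite -subr_eq0 -normr_le0.
  apply: (@le_geometric _ _ _ (3 * r)) => k; rewrite add0r.
  rewrite -(subrKA (u k.+1 t)); apply: le_trans (ler_normD _ _) _.
  have H1 := Tcontr x (u k) _ Sx (uS k) (fun t => xP t k) t.
  have H2 := xP t k.+1; rewrite distrC in H2.
  apply: le_trans (lerD H1 H2) _.
  have -> : 2 * r * 2^-1 ^+ k / 2 + 2 * r * 2^-1 ^+ k.+1 = 2 * r * 2^-1 ^+ k.
    by rewrite exprS; field.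
  by rewrite ler_wpM2r ?exprn_ge0//; lra.
exists x; split; first by rewrite -Tx /T tau0 subrr addr0.
  exact: Sx.1.
move=> t ta.
have dP : is_derive t 1 (fun s =>
  P (F \o x) s + (x0 - P (F \o x) 0)) (F (x t) + 0).
  apply: is_deriveD; apply: (PP _ (FS x Sx)).
  by move: ta; rewrite ltr_norml => /andP[? ?]; lra.
rewrite addr0 in dP.
apply: near_eq_is_derive dP.
near=> s; rewrite -Tx /T tau_id; first by rewrite addrCA.
near: s; apply/nbhs_ballP; exists (a - `|t|); first by rewrite /= subr_gt0.
move=> s /=; rewrite /ball /= ltrBrDl => /ltW; apply: le_trans.
by have := ler_normB t (t - s); rewrite opprB addrCA subrr addr0.
Unshelve. all: by end_near. Qed.

End Picard.

Section SmoothOde.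
Context {R : realType}.

Lemma is_derive_real (W : normedModType R) (x : R -> W) (t v : R) l :
  is_derive t 1 x l -> is_derive t v x (v *: l).
Proof.
move=> [dx <-]; have dx' : differentiable x t by exact/derivable1_diffP.
apply: DeriveDef; first exact: diff_derivable.
rewrite !deriveE//; have -> : v = v *: (1 : R) by rewrite [RHS]mulr1.
by rewrite linearZ/= [_ *: 1]mulr1.
Qed.

Context {m n : nat}.
Local Notation V := 'M[R]_(m, n).

(** Near x0 the partial derivatives are bounded by continuity; integrate along
    segments of a ball, by the mean value inequality. *)
Lemma Ck_locally_lipschitz (U : set V) (F : V -> V) x0 : open U -> Ck 1 U F ->
  U x0 -> exists r L : R, [/\ 0 < r, 0 <= L,
    forall x, `|x - x0| <= r -> U x &
    forall x y, `|x - x0| <= r -> `|y - x0| <= r ->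
      `|F x - F y| <= L * `|x - y|].
Proof.
move=> oU F1 Ux0.
pose C i j : R := `|'D_(delta_mx i j) F x0| + 1.
have : \forall x \near x0, U x /\ forall i j, `|'D_(delta_mx i j) F x| <= C i j.
  apply: filterI; first exact: open_nbhs_nbhs.
  apply: (@filter_forall _ _ _ _ (nbhs_filter x0)) => i.
  apply: (@filter_forall _ _ _ _ (nbhs_filter x0)) => j.
  have D_cont : 'D_(delta_mx i j) F @ nbhs x0 --> 'D_(delta_mx i j) F x0.
    exact: (Ck_continuous (Ck_derive _ F1) Ux0).
  have lt_C : `|'D_(delta_mx i j) F x0| < C i j by rewrite /C ltrDl.
  exact: (@cvgr_norm_le _ _ _ (nbhs x0) (nbhs_filter x0) _ _ D_cont _ lt_C).
move=> /nbhs_ballP[e /= e0 near_x0].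
have in_ball x : `|x - x0| <= e / 2 -> ball x0 e x.
  by move=> xe; rewrite -ball_normE /= distrC; lra.
exists (e / 2), (\sum_i \sum_j C i j); split.
- lra.
- by do 2 apply: sumr_ge0 => ? _; rewrite addr_ge0.
- by move=> x /in_ball /near_x0[].
move=> x y xe ye.
pose g (s : R) := F (s *: (x - y) + y).
have seg (s : R) : 0 <= s <= 1 -> `|s *: (x - y) + y - x0| <= e / 2.
  move=> /andP[s0 s1].
  have -> : s *: (x - y) + y - x0 = s *: (x - x0) + (1 - s) *: (y - x0).
    rewrite !scalerBr !scalerBl !scale1r !opprB !addrA.
    by apply/matrixP => i j; rewrite !mxE; ring.
  apply: le_trans (ler_normD _ _) _;
    rewrite !normrZ ger0_norm// ger0_norm ?subr_ge0//.
  have s1' : 0 <= 1 - s by lra.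
  have := lerD (ler_wpM2l s0 xe) (ler_wpM2l s1' ye); lra.
have dg (s : R) : 0 <= s <= 1 ->
  is_derive s 1 g ('D_(x - y) F (s *: (x - y) + y)).
  move=> s01; apply: is_derive_along_line.
  by apply: Ck_is_derive F1 _; have [] := near_x0 _ (in_ball _ (seg s s01)).
have := @norm_increment_le _ _ g (\sum_i \sum_j C i j * `|x - y|) 0 1 ler01.
rewrite /g scale1r scale0r add0r subrK subr0 mulr1 mulr_suml.
under [in X in _ -> X]eq_bigr do rewrite mulr_suml.
apply => s s01; first by case: (dg s s01).
case: (dg s s01) => _ ->.
have [Us HC] := near_x0 _ (in_ball _ (seg s s01)).
have dF : differentiable F (s *: (x - y) + y) by exact: Ck_differentiable F1 Us.
rewrite deriveE// diff_mxE//.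
apply: le_trans (ler_norm_sum _ _ _) _; apply: ler_sum => i _.
apply: le_trans (ler_norm_sum _ _ _) _; apply: ler_sum => j _.
by rewrite normrZ mulrC ler_pM// ler_mx_entry.
Qed.

(** Smoothness is a bootstrap: x' = F o x, so x is C^(k+1) once it is C^k. *)
Theorem smooth_ode (U : set V) (F : V -> V) x0 : open U -> smooth U F -> U x0 ->
  exists (a : R) (x : R -> V), [/\ 0 < a, x 0 = x0,
    forall t : R, `|t| < a -> U (x t),
    forall t : R, `|t| < a -> is_derive t 1 x (F (x t)) &
    smooth [set t : R | `|t| < a] x].
Proof.
move=> oU F_smooth Ux0.
have [r [L [r0 L0 rU FL]]] := Ck_locally_lipschitz oU (F_smooth 1%N) Ux0.
pose K := `|F x0| + L * r.
have FK x : `|x - x0| <= r -> `|F x| <= K.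
  move=> xr; rewrite -[F x](subrK (F x0)) addrC.
  apply: le_trans (ler_normD _ _) _; rewrite lerD2l.
  apply: le_trans (FL _ _ xr _) _; first by rewrite subrr normr0 ltW.
  exact: ler_wpM2l.
have K0 : 0 <= K by rewrite addr_ge0// mulr_ge0// ltW.
pose a := Num.min (2^-1 / (L + 1)) (r / (K + 1)).
have L1 : 0 < L + 1 by lra.
have K1 : 0 < K + 1 by lra.
have a0 : 0 < a by rewrite lt_min !divr_gt0.
have aL : a * L <= 2^-1.
  apply: (@le_trans _ _ (a * (L + 1))); first by rewrite ler_wpM2l ?ltW//; lra.
  by rewrite -ler_pdivlMr// ge_min lexx.
have aK : a * K <= r.
  apply: (@le_trans _ _ (a * (K + 1))); first by rewrite ler_wpM2l ?ltW//; lra.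
  by rewrite -ler_pdivlMr// ge_min lexx orbT.
have [x [x00 xr dx]] := picard a0 (ltW r0) L0 FK FL aL aK.
exists a, x; split=> //; first by move=> t _; exact: rU.
have oI : open [set t : R | `|t| < a].
  exact: open_norm_lt.
have cx (t : R) : `|t| < a -> {for t, continuous x}.
  by move=> /dx[d _]; exact/differentiable_continuous/derivable1_diffP.
elim=> [|k IH]; first by split.
apply: (@Ck_is_deriveP _ _ _ _ _ _ (fun (v : R) t => v *: F (x t))) => //.
  by move=> t v /= ta; apply: is_derive_real; exact: dx.
move=> v; apply: CkZ => //; first exact: Ck_cst.
by apply: (Ck_comp oI oU _ IH (F_smooth k)) => t _; exact: rU.
Qed.

End SmoothOde.

(** * Bilinear forms and null frames *)

Section BilinearForms.
Context {R : realType} {n : nat}.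
Implicit Types (G : 'M[R]_n) (u v w : 'rV[R]_n).

Lemma bformDl G u v w : bform G (u + v) w = bform G u w + bform G v w.
Proof. by rewrite /bform !mulmxDl mxE. Qed.

Lemma bformDr G u v w : bform G w (u + v) = bform G w u + bform G w v.
Proof. by rewrite /bform linearD mulmxDr mxE. Qed.

Lemma bformZl G (a : R) u v : bform G (a *: u) v = a * bform G u v.
Proof. by rewrite /bform -!scalemxAl mxE. Qed.

Lemma bformZr G (a : R) u v : bform G u (a *: v) = a * bform G u v.
Proof. by rewrite /bform linearZ -scalemxAr mxE. Qed.

Lemma bformNl G u v : bform G (- u) v = - bform G u v.
Proof. by rewrite -scaleN1r bformZl mulN1r. Qed.

Lemma bformNr G u v : bform G u (- v) = - bform G u v.
Proof. by rewrite -scaleN1r bformZr mulN1r. Qed.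

Lemma bform0l G u : bform G 0 u = 0.
Proof. by rewrite /bform !mul0mx mxE. Qed.

Lemma bform_suml G (J : Type) (r : seq J) (a : J -> R)
    (u : 'rV[R]_n) (w : J -> 'rV[R]_n) :
  bform G (\sum_(i <- r) a i *: w i) u = \sum_(i <- r) a i * bform G (w i) u.
Proof.
elim: r => [|i r IH]; last by rewrite !big_cons bformDl bformZl IH.
by rewrite !big_nil bform0l.
Qed.

Lemma bform_sumr G (J : Type) (r : seq J) (a : J -> R) (u : 'rV[R]_n)
    (w : J -> 'rV[R]_n) :
  bform G u (\sum_(i <- r) a i *: w i) = \sum_(i <- r) a i * bform G u (w i).
Proof.
elim: r => [|i r IH]; last by rewrite !big_cons bformDr bformZr IH.
by rewrite !big_nil -[X in bform G u X](scale0r (0 : 'rV[R]_n)) bformZr mul0r.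
Qed.

Lemma bform_delta G i j :
  bform G (delta_mx 0 i) (delta_mx 0 j) = G i j.
Proof. by rewrite /bform -rowE trmx_delta -colE !mxE. Qed.

Lemma bform_sym G u v : G^T = G -> bform G u v = bform G v u.
Proof.
by move=> G_sym; rewrite /bform -[in LHS](trmxK
  (u *m G *m v^T)) mxE !trmx_mul trmxK G_sym mulmxA.
Qed.

Lemma bform_ker G (u v : 'rV[R]_n) :
  (u <= kermx (G *m v^T))%MS <-> bform G u v = 0.
Proof.
rewrite /bform -mulmxA; split=> [/sub_kermxP ->|uv0]; first by rewrite mxE.
by apply/sub_kermxP/matrixP => i j; rewrite !ord1 uv0 mxE.
Qed.

Lemma bform_normalize G u : bform G u u != 0 ->
  let c := (Num.sqrt `|bform G u u|)^-1 in
  bform G (c *: u) (c *: u) = Num.sg (bform G u u).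
Proof.
move=> u0 c; rewrite bformZl bformZr mulrA.
have s0 : 0 < `|bform G u u| by rewrite normr_gt0.
rewrite /c -invfM -expr2 sqr_sqrtr ?ltW//.
by rewrite [X in _ * X]numEsg mulrCA mulVf ?mulr1// gt_eqF.
Qed.

End BilinearForms.

Section NullFrames.
Context {R : realType}.
Implicit Types (G : 'M[R]_3) (u v w : 'rV[R]_3).

Definition null_triple G (z n w : 'rV[R]_3) : Prop :=
  [/\ bform G z z = 0, bform G z n = 1, bform G n n = 0 &
   [/\ bform G z w = 0, bform G n w = 0 & bform G w w = -1]].

(** A vector e3 orthogonal to a negative definite plane W is positive: otherwise
    the form would be degenerate, or negative definite on the whole space,
    against the index being 2. With e1, e2 orthonormal in W and e3 normalized,
    the null frame is e1 + e3, (e3 - e1)/2, e2. *)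
Lemma null_triple_exists G : G^T = G -> G \in unitmx -> has_index G 2 ->
  exists z n w, null_triple G z n w.
Proof.
move=> G_sym G_unit [[W [W_neg W_rank]] W_max].
have rank_row u : (\rank u <= 1)%N by exact: rank_leq_row.
have [e3 e3_orth e3_neq0] : exists2 e3 : 'rV[R]_3,
    (e3 <= kermx (G *m W^T))%MS & e3 != 0.
  apply/rowV0Pn; rewrite -mxrank_eq0 mxrank_ker.
  have := mxrankM_maxr G W^T; rewrite mxrank_tr W_rank => /leq_trans h.
  by rewrite subn_eq0 -ltnNge ltnS; exact: h.
have W_orth v : (v <= W)%MS -> bform G e3 v = 0.
  move=> /submxP[a ->]; rewrite /bform trmx_mul mulmxA.
  by move/sub_kermxP: e3_orth; rewrite mulmxA => ->; rewrite mul0mx mxE.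
have e3_notin : ~~ (e3 <= W)%MS.
  apply/negP => e3W; have := W_neg _ e3W e3_neq0.
  by rewrite W_orth// ltxx.
have full : (W + e3 :=: 1%:M)%MS.
  apply/eqmxP; rewrite submx1/= sub1mx /row_full eqn_leq rank_leq_col/=.
  rewrite -[X in (X < _)%N]W_rank.
  have : (W < W + e3)%MS.
    by rewrite ltmxE addsmxSl/= addsmx_sub submx_refl.
  by rewrite ltmxErank => /andP[].
have decomp v : exists2 w, (w <= W)%MS & exists a : R, v = w + a *: e3.
  have : (v <= W + e3)%MS by rewrite full submx1.
  move=> /sub_addsmxP[[a b]] /= ->; exists (a *m W); first exact: submxMl.
  by exists (b 0 0); rewrite [b in LHS]mx11_scalar mul_scalar_mx.
have e3_pos : 0 < bform G e3 e3.
  rewrite ltNge; apply/negP => e3_le0.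
  have [e3e3|e3e3] := eqVneq (bform G e3 e3) 0.
    have e3G : e3 *m G = 0.
      apply/rowP => i; rewrite [RHS]mxE.
      have [w wW [a dE]] := decomp (delta_mx 0 i).
      have : bform G e3 (delta_mx 0 i) = 0.
        by rewrite dE bformDr bformZr e3e3 mulr0 addr0 W_orth.
      by rewrite /bform trmx_delta -colE mxE.
    by move/eqP: e3_neq0; apply; rewrite -(mulmxK G_unit e3) e3G mul0mx.
  have := W_max 1%:M; rewrite mxrank1 ltnn => /(_ _)/negP; apply=> //.
  move=> v _ v0; have [w wW [a vE]] := decomp v.
  rewrite vE bformDl !bformDr !bformZl !bformZr (bform_sym w e3)//.
  rewrite W_orth// mulr0 addr0 add0r.
  have [w0|w0] := eqVneq w 0.
    rewrite w0 bform0l add0r mulrA -expr2.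
    have a0 : a != 0 by apply: contraNneq v0 => a0;
      rewrite vE w0 a0 scale0r addr0.
    have a2 : 0 < a ^+ 2 by rewrite exprn_even_gt0.
    by rewrite pmulr_rlt0// lt_neqAle e3e3.
  apply: ltr_wnDr; last exact: W_neg.
  by rewrite mulrA -expr2 mulr_ge0_le0// sqr_ge0.
have [e1 e1W e1_neq0] : exists2 e1 : 'rV[R]_3, (e1 <= W)%MS & e1 != 0.
  by apply/rowV0Pn; rewrite -mxrank_eq0 W_rank.
have [e2] : exists2 e2 : 'rV[R]_3,
    (e2 <= W :&: kermx (G *m e1^T))%MS & e2 != 0.
  apply/rowV0Pn; rewrite -mxrank_eq0 -lt0n.
  have := mxrank_sum_cap W (kermx (G *m e1^T)); rewrite W_rank mxrank_ker.
  have := rank_leq_col (W + kermx (G *m e1^T))%MS.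
  have : (\rank (G *m e1^T) <= 1)%N by exact: rank_leq_col.
  move: (\rank _) (\rank _) (\rank _) => x y z; lia.
rewrite sub_capmx => /andP[e2W /bform_ker e2e1] e2_neq0.
have e1e1 := W_neg _ e1W e1_neq0; have e2e2 := W_neg _ e2W e2_neq0.

pose nrm u := (Num.sqrt `|bform G u u|)^-1 *: u.
have nrm1 : bform G (nrm e1) (nrm e1) = -1.
  by rewrite bform_normalize ?lt_eqF// ltr0_sg.
have nrm2 : bform G (nrm e2) (nrm e2) = -1.
  by rewrite bform_normalize ?lt_eqF// ltr0_sg.
have nrm3 : bform G (nrm e3) (nrm e3) = 1.
  by rewrite bform_normalize ?gt_eqF// gtr0_sg.
have o12 : bform G (nrm e1) (nrm e2) = 0.
  by rewrite bformZl bformZr bform_sym// e2e1 !mulr0.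
have o31 : bform G (nrm e3) (nrm e1) = 0.
  by rewrite bformZl bformZr (W_orth e1)// !mulr0.
have o32 : bform G (nrm e3) (nrm e2) = 0.
  by rewrite bformZl bformZr (W_orth e2)// !mulr0.
have o13 : bform G (nrm e1) (nrm e3) = 0 by rewrite bform_sym.
exists (nrm e1 + nrm e3), (2^-1 *: (nrm e3 - nrm e1)), (nrm e2).
move: (nrm e1) (nrm e2) (nrm e3) nrm1 nrm2 nrm3 o12 o31 o32 o13 => u1 u2 u3 *.
by split; last split; rewrite ?(bformDl, bformDr, bformZl, bformZr, bformNl,
  bformNr); lra.
Qed.

(** The orthogonal of z is a plane, because the form pairs z with n, and it
    contains the independent vectors z and w. *)
Lemma null_triple_screen G z n w : G^T = G -> null_triple G z n w ->
  [/\ \rank <<w>>%MS = 1%N,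
      forall v, (v <= <<w>>)%MS -> v != 0 ->
        exists2 v', (v' <= <<w>>)%MS & bform G v v' != 0,
      (z :&: <<w>> = 0)%MS &
      forall v, (v <= z + <<w>>)%MS <-> bform G v z = 0].
Proof.
move=> G_sym [zz zn nn [zw nw ww]].
have neq0 u v : bform G u v != 0 -> u != 0.
  by apply: contraNneq => ->; rewrite bform0l.
have w0 : w != 0 by apply: (neq0 _ w); rewrite ww oppr_eq0 oner_eq0.
have z0 : z != 0 by apply: (neq0 _ n); rewrite zn oner_eq0.
have wz : bform G w z = 0 by rewrite bform_sym.
have in_w v : (v <= <<w>>)%MS -> exists a : R, v = a *: w.
  by rewrite genmxE => /sub_rVP.
have cap0 : (z :&: <<w>> = 0)%MS.
  apply/eqP; rewrite -submx0; apply/rV_subP => v.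
  rewrite sub_capmx => /andP[/sub_rVP[a ->] /in_w[b ab]].
  have : bform G (a *: z) w = bform G (b *: w) w by rewrite ab.
  rewrite !bformZl zw ww mulr0 mulrN1 => /eqP;
    rewrite eq_sym oppr_eq0 => /eqP b0.
  by rewrite ab b0 scale0r sub0mx.
have rw : \rank <<w>>%MS = 1%N by rewrite genmxE rank_rV w0.
split=> //.
  move=> v /in_w[a ->] av0; exists w; first by rewrite genmxE.
  rewrite bformZl ww mulrN1 oppr_eq0.
  by apply: contraNneq av0 => ->; rewrite scale0r.
have eqK : (z + <<w>> :=: kermx (G *m z^T))%MS.
  apply/eqmxP; rewrite -mxrank_leqif_eq; last first.
    rewrite addsmx_sub genmxE; apply/andP; split; exact/bform_ker.
  have := mxrank_sum_cap z <<w>>%MS; rewrite cap0 mxrank0 addn0 => ->.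
  rewrite rw rank_rV z0 mxrank_ker.
  suff -> : \rank (G *m z^T) = 1%N by [].
  apply/eqP; rewrite eqn_leq rank_leq_col/= lt0n mxrank_eq0.
  apply/eqP => Gz; have : bform G n z = 0
    by rewrite /bform -mulmxA Gz mulmx0 mxE.
  by rewrite bform_sym// zn => /eqP; rewrite oner_eq0.
by move=> v; rewrite eqK; exact: bform_ker.
Qed.

End NullFrames.

(** * Charts, coordinate fields and smooth functions *)

Section Charts.
Context {R : realType} {n : nat} {M : manifold R n}.
Implicit Types (c d e : chart M) (p : M) (U : set M) (W : normedModType R).

Lemma img_dom c p : dom c p -> (phi c @` dom c) (phi c p).
Proof. by move=> cp; exists p. Qed.

Lemma imgP c U x : (phi c @` (dom c `&` U)) x <->
  [/\ (phi c @` dom c) x, dom c (psi c x), U (psi c x) & phi c (psi c x) = x].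
Proof.
split=> [[p [cp Up] <-]|[_ cx Ux <-]]; last by exists (psi c x).
by rewrite phiK//; split=> //; exists p.
Qed.

Lemma img1P c x : (phi c @` dom c) x -> dom c (psi c x) /\ phi c (psi c x) = x.
Proof. by move=> [p cp <-]; rewrite phiK. Qed.

Lemma img_openI c U : open U -> open (phi c @` (dom c `&` U)).
Proof.
move=> oU; rewrite openE => x /imgP[cx dx Ux xE].
have n1 : nbhs x (phi c @` dom c) by apply: open_nbhs_nbhs; split=> //;
  exact: img_open.
have n2 : nbhs x (psi c @^-1` U).
  apply: (psi_continuous cx); exact: open_nbhs_nbhs.
rewrite /interior; apply: filterS2 n1 n2 => y cy Uy.
by have [dy yE] := img1P cy; apply/imgP; split.
Qed.

(** The differential at p of the change of charts from c to d. Both [coords] and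
    [const_field] are instances, where one chart is the preferred one at p. *)
Definition Jac c d p (u : 'rV[R]_n) : 'rV[R]_n :=
  'D_u (phi d \o psi c) (phi c p).

Lemma coordsE c p (u : tangent p) : coords c u = Jac (chart_at p) c p u.
Proof. by []. Qed.

Lemma const_fieldE c u p : const_field c u p = Jac c (chart_at p) p u.
Proof. by []. Qed.

Lemma transition_differentiable c d p : dom c p -> dom d p ->
  differentiable (phi d \o psi c) (phi c p).
Proof.
move=> cp dp; apply: (@Ck_differentiable _ _ _ _ 0 (phi c @`
  (dom c `&` dom d))).
- exact/img_openI/dom_open.
- exact: transition_smooth.
- by exists p.
Qed.

Lemma Jac_diff c d p u : dom c p -> dom d p ->
  Jac c d p u = 'd (phi d \o psi c) (phi c p) u.
Proof. by move=> cp dp; rewrite /Jac deriveE//;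
  exact: transition_differentiable. Qed.

Lemma JacP c d p (a : R) u v : dom c p -> dom d p ->
  Jac c d p (a *: u + v) = a *: Jac c d p u + Jac c d p v.
Proof. by move=> cp dp; rewrite !Jac_diff// linearP. Qed.

Lemma Jac0 c d p : Jac c d p 0 = 0.
Proof. by rewrite /Jac derive0. Qed.

Lemma Jac_sum c d p (I : Type) (r : seq I) (a : I -> R) (u : I -> 'rV[R]_n) :
  dom c p -> dom d p ->
  Jac c d p (\sum_(i <- r) a i *: u i) = \sum_(i <- r) a i *: Jac c d p (u i).
Proof.
move=> cp dp; rewrite !Jac_diff// linear_sum; apply: eq_bigr => i _.
by rewrite linearZ/= Jac_diff.
Qed.

Definition rep_differentiable W (F : M -> W) p : Prop :=
  forall c, dom c p -> differentiable (F \o psi c) (phi c p).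

Lemma smooth_on_rep W U (F : M -> W) p : open U -> smooth_on U F -> U p ->
  rep_differentiable F p.
Proof.
move=> oU Fs Up c cp.
apply: (@Ck_differentiable _ _ _ _ 0 (phi c @` (dom c `&` U))).
- exact: img_openI.
- exact: Fs.
- by exists p.
Qed.

Lemma near_img c d p : dom c p -> dom d p ->
  \forall y \near phi c p, dom c (psi c y) /\ dom d (psi c y).
Proof.
move=> cp dp; have : nbhs (phi c p) (phi c @` (dom c `&` dom d)).
  by apply: open_nbhs_nbhs; split; [exact/img_openI/dom_open|exists p].
by apply: filterS => y /imgP[].
Qed.

Lemma rep_change W (F : M -> W) p c d : dom c p -> dom d p ->
  \forall y \near phi c p, (F \o psi c) y = (F \o psi d) ((phi d \o psi c) y).
Proof.
by move=> cp dp; apply: filterS (near_img cp dp) => y [cy dy] /=; rewrite phiK.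
Qed.

(** Chain rule through the change of charts; all covariance statements reduce
    to it. *)
Lemma derive_rep_Jac W (F : M -> W) p c d u : dom c p -> dom d p ->
  differentiable (F \o psi d) (phi d p) ->
  'D_u (F \o psi c) (phi c p) = 'D_(Jac c d p u) (F \o psi d) (phi d p).
Proof.
move=> cp dp dF.
have pE : phi d p = (phi d \o psi c) (phi c p) by rewrite /= phiK.
rewrite (near_eq_derive _ (rep_change F cp dp)) [in RHS]deriveE//.
rewrite {}pE in dF *; rewrite /Jac.
have := transition_differentiable cp dp; move: dF.
move: (F \o psi d) (phi d \o psi c) (phi c p) => G T x dG dT.
have T' : is_derive x u T ('D_u T x) by apply: DeriveDef => //;
  exact: diff_derivable.
by case: (is_derive_comp dG T').
Qed.

Lemma Jac_comp c d e p u : dom c p -> dom d p -> dom e p ->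
  Jac d e p (Jac c d p u) = Jac c e p u.
Proof.
move=> cp dp ep; rewrite [RHS]/Jac (derive_rep_Jac _ cp dp)//.
exact: transition_differentiable.
Qed.

Lemma Jac_id c p u : dom c p -> Jac c c p u = u.
Proof.
move=> cp; rewrite /Jac (near_eq_derive (g := id)) ?derive_id//.
have : nbhs (phi c p) (phi c @` dom c).
  by apply: open_nbhs_nbhs; split; [exact: img_open|exists p].
by apply: filterS => y /img1P[_].
Qed.

Lemma coords_const_field c p u : dom c p ->
  coords c (const_field c u p : tangent p) = u.
Proof.
move=> cp; rewrite coordsE const_fieldE Jac_comp ?Jac_id//; exact: dom_chart_at.
Qed.

Lemma const_field_coords c p (u : tangent p) : dom c p ->
  const_field c (coords c u) p = u.
Proof.
move=> cp; rewrite const_fieldE coordsE Jac_comp ?Jac_id//; exact: dom_chart_at.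
Qed.

Lemma coords_const_field2 c d p u : dom c p -> dom d p ->
  coords d (const_field c u p : tangent p) = Jac c d p u.
Proof. by move=> cp dp; rewrite coordsE const_fieldE Jac_comp//;
  exact: dom_chart_at. Qed.

Lemma const_fieldP c p (a : R) u v : dom c p ->
  const_field c (a *: u + v) p = a *: const_field c u p + const_field c v p.
Proof. by move=> cp; rewrite !const_fieldE JacP//; exact: dom_chart_at. Qed.

Lemma const_field0 c p : const_field c 0 p = 0 :> 'rV[R]_n.
Proof. exact: Jac0. Qed.

Lemma const_field_sum c p (I : Type) (r : seq I) (a : I -> R)
    (u : I -> 'rV[R]_n) : dom c p ->
  const_field c (\sum_(i <- r) a i *: u i) p =
    \sum_(i <- r) a i *: const_field c (u i) p.
Proof. by move=> cp; rewrite !const_fieldE Jac_sum//; exact: dom_chart_at. Qed.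

Lemma tdiff_const_field W (F : M -> W) p c u : dom c p ->
  rep_differentiable F p ->
  tdiff F (const_field c u p : tangent p) = 'D_u (F \o psi c) (phi c p).
Proof.
move=> cp dF; rewrite /tdiff const_fieldE [RHS](derive_rep_Jac _ cp
  (dom_chart_at p))//.
exact/dF/dom_chart_at.
Qed.

Lemma smooth_on_subset W U U' (F : M -> W) : U' `<=` U -> smooth_on U F ->
  smooth_on U' F.
Proof.
move=> UU' Fs c k; apply: Ck_subset (Fs c k).
by move=> _ [q [cq U'q] <-]; exists q => //; split=> //; exact: UU'.
Qed.

Lemma smooth_on_eq W U (F G : M -> W) : open U ->
  (forall p, U p -> F p = G p) ->
  smooth_on U F -> smooth_on U G.
Proof.
move=> oU FG Fs c k; apply: Ck_eq (Fs c k); first exact: img_openI.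
by move=> y /imgP[_ _ Uy _] /=; exact: FG.
Qed.

Lemma smooth_on_cst W U (a : W) : smooth_on U (fun _ : M => a).
Proof. by move=> c k; exact: Ck_cst. Qed.

Lemma smooth_on_entry m l U (F : M -> 'M[R]_(m, l)) i j : open U ->
  smooth_on U F -> smooth_on U (fun p => F p i j).
Proof.
move=> oU Fs c k.
exact: (@Ck_entry _ _ _ _ _ _ (F \o psi c) i j (img_openI oU) (Fs c k)).
Qed.

(** In a chart d the components of the field are a partial derivative of the
    transition map from c to d. *)
Lemma const_field_smooth c u : vfield_smooth (dom c) (const_field c u).
Proof.
move=> d; have oU : open (dom c `&` dom d) by apply: openI; exact: dom_open.
apply: (@smooth_on_eq _ _ (fun p => Jac c d p u)) => //.
  by move=> p [cp dp]; rewrite coords_const_field2.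
move=> e k.
apply: (@Ck_comp _ _ _ _ _ _ _ (phi c @` (dom c `&` dom d))
   (phi c \o psi e) ('D_u (phi d \o psi c))).
- exact: img_openI.
- exact/img_openI/dom_open.
- by move=> y /imgP[_ _ [cy dy] _] /=; exists (psi e y).
- apply: Ck_subset (transition_smooth e c k) => _ [q [eq [cq dq]] <-].
  by exists q.
- exact: (Ck_derive u (transition_smooth c d k.+1)).
Qed.

Lemma vfield_smooth_subset U U' (X : vfield M) : U' `<=` U ->
  vfield_smooth U X -> vfield_smooth U' X.
Proof. by move=> UU' Xs c; apply: smooth_on_subset (Xs c); exact: setSI. Qed.

Lemma vfield_smooth_eq U (X Y : vfield M) : open U ->
  (forall p, U p -> X p = Y p) ->
  vfield_smooth U X -> vfield_smooth U Y.
Proof.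
move=> oU XY Xs c; apply: smooth_on_eq (Xs c); first exact/openI/dom_open.
by move=> p [Up cp]; rewrite XY.
Qed.

Lemma vfield_smooth0 U (X : vfield M) : open U -> (forall p, U p -> X p = 0) ->
  vfield_smooth U X.
Proof.
move=> oU X0 c; apply: (@smooth_on_eq _ _ (fun=> 0)).
- exact/openI/dom_open.
- by move=> p [Up _]; rewrite X0// coordsE Jac0.
- exact: smooth_on_cst.
Qed.

End Charts.

(** * Locality and tensoriality of connections *)

Section Connections.
Context {R : realType} {n : nat} {M : manifold R n}.
Variable nabla : vfield M -> vfield M -> vfield M.
Hypothesis nablaP : is_connection nabla.
Implicit Types (c d e : chart M) (p : M) (U : set M) (W : normedModType R).
Implicit Types (X Y Z : vfield M).

Lemma coords_linear c p (a : R) (u v : tangent p) : dom c p ->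
  coords c (a *: u + v : tangent p) = a *: coords c u + coords c v.
Proof. by move=> cp; rewrite coordsE JacP//; exact: dom_chart_at. Qed.

Lemma coords_self p (u : tangent p) : coords (chart_at p) u = u.
Proof. by rewrite coordsE Jac_id//; exact: dom_chart_at. Qed.

Lemma vfield_smoothP U X Y (a : M -> R) : open U -> smooth_on U a ->
  vfield_smooth U X -> vfield_smooth U Y ->
  vfield_smooth U (fun q => a q *: X q + Y q).
Proof.
move=> oU a_smooth Xs Ys c.
have oUc : open (U `&` dom c) by apply: openI => //; exact: dom_open.
apply: (@smooth_on_eq _ _ _ _ _ (fun q => a q *: coords c (X q : tangent q) +
    coords c (Y q : tangent q))) => //.
  by move=> q [Uq cq]; rewrite coords_linear.
move=> e k; apply: (@CkD _ _ _ _ _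
  (fun y => a (psi e y) *: coords c (X (psi e y) : tangent (psi e y)))).
- exact: img_openI.
- apply: (@CkZ _ _ _ _ _ (a \o psi e)).
  + exact: img_openI.
  + apply: Ck_subset (a_smooth e k) => _ [q [eq [Uq _]] <-]; by exists q.
  + exact: (Xs c e k).
- exact: (Ys c e k).
Qed.

Lemma vfield_smooth_sum U (I : Type) (r : seq I) (a : I -> M -> R)
    (X : I -> vfield M) :
  open U -> (forall i, smooth_on U (a i)) ->
  (forall i, vfield_smooth U (X i)) ->
  vfield_smooth U (fun q => \sum_(i <- r) a i q *: X i q).
Proof.
move=> oU a_smooth Xs; elim: r => [|i r IH].
  by apply: vfield_smooth0 => // p _; rewrite big_nil.
apply: vfield_smooth_eq (vfield_smoothP oU (a_smooth i) (Xs i) IH) => // p _.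
by rewrite big_cons.
Qed.

(** A field Z vanishing on U satisfies Z = off U *: Z everywhere, while off U is
    smooth on U, being zero there. This is how the values of fields outside U
    are removed from the axioms of a connection. *)
Definition off U (q : M) : R := if `[< U q >] then 0 else 1.

Lemma off_smooth U : open U -> smooth_on U (off U).
Proof.
move=> oU; apply: (@smooth_on_eq _ _ _ _ _ (fun=> 0)) => //;
  last exact: smooth_on_cst.
by move=> p Up; rewrite /off asboolT.
Qed.

Lemma off_decomp U X X' : (forall p, U p -> X p = X' p) ->
  X = (fun q => off U q *: (X q - X' q) + X' q).
Proof.
move=> XX'; apply/funext => q; rewrite /off.
by case: asboolP => [/XX' ->|_]; rewrite ?scale0r ?add0r// scale1r subrK.
Qed.

Lemma diff_smooth U X X' : open U -> (forall p, U p -> X p = X' p) ->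
  vfield_smooth U (fun q => X q - X' q).
Proof. by move=> oU XX'; apply: vfield_smooth0 => // p /XX' ->;
  rewrite subrr. Qed.

(** The identity X = off U *: (X - X') + X' holds between total functions, so the
    axioms apply to it; at a point of U only the last term contributes. *)
Lemma nabla_local U X X' Y Y' p : open U ->
  vfield_smooth U X' -> vfield_smooth U Y' ->
  (forall q, U q -> X q = X' q) -> (forall q, U q -> Y q = Y' q) ->
  U p -> nabla X Y p = nabla X' Y' p.
Proof.
move=> oU Xs Ys XX' YY' Up.
have Ys' : vfield_smooth U Y by apply: vfield_smooth_eq Ys => // q /YY'.
have off0 : off U p = 0 by rewrite /off asboolT.
rewrite (off_decomp XX') (nabla_linear nablaP oU (diff_smooth oU XX') Xs Ys'
  (off_smooth oU) Up).
rewrite off0 scale0r add0r (off_decomp YY').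
rewrite (nabla_leibniz nablaP oU Xs (diff_smooth oU YY') Ys (off_smooth oU) Up).
by rewrite off0 scale0r addr0 YY'// subrr scaler0 add0r.
Qed.

Lemma nabla0l U Y p : open U -> vfield_smooth U Y -> U p ->
  nabla (fun=> 0) Y p = 0.
Proof.
move=> oU Ys Up; have Zs : vfield_smooth U (fun _ : M => 0 : 'rV[R]_n).
  exact: vfield_smooth0.
have := nabla_linear nablaP oU Zs Zs Ys (smooth_on_cst U (1 : R)) Up.
have -> : (fun q : M => (1 : R) *: 0 + 0) = (fun=> 0 : 'rV[R]_n).
  by apply/funext => q; rewrite scaler0 addr0.
by rewrite scale1r => /eqP;
  rewrite -subr_eq0 opprD addrA subrr add0r oppr_eq0 => /eqP.
Qed.

Lemma nabla0r U X p : open U -> vfield_smooth U X -> U p ->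
  nabla X (fun=> 0) p = 0.
Proof.
move=> oU Xs Up; have Zs : vfield_smooth U (fun _ : M => 0 : 'rV[R]_n).
  exact: vfield_smooth0.
have := nabla_leibniz nablaP oU Xs Zs Zs (smooth_on_cst U (1 : R)) Up.
have -> : (fun q : M => (1 : R) *: 0 + 0) = (fun=> 0 : 'rV[R]_n).
  by apply/funext => q; rewrite scaler0 addr0.
by rewrite scaler0 add0r scale1r => /eqP;
  rewrite -subr_eq0 opprD addrA subrr add0r oppr_eq0 => /eqP.
Qed.

Lemma nabla_sum_l U (I : Type) (r : seq I) (a : I -> M -> R) (X : I ->
  vfield M) Y p :
  open U -> (forall i, smooth_on U (a i)) ->
    (forall i, vfield_smooth U (X i)) ->
  vfield_smooth U Y -> U p ->
  nabla (fun q => \sum_(i <- r) a i q *: X i q) Y p =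
  \sum_(i <- r) a i p *: nabla (X i) Y p.
Proof.
move=> oU a_smooth Xs Ys Up; elim: r => [|i r IH].
  have -> : (fun q => \sum_(i <- [::]) a i q *: X i q) = (fun=> 0).
    by apply/funext => q; rewrite big_nil.
  by rewrite big_nil; exact: (nabla0l oU Ys Up).
have -> : (fun q => \sum_(j <- i :: r) a j q *: X j q) =
    (fun q => a i q *: X i q + \sum_(j <- r) a j q *: X j q).
  by apply/funext => q; rewrite big_cons.
have Ss := vfield_smooth_sum r oU a_smooth Xs.
by rewrite (nabla_linear nablaP oU (Xs i) Ss Ys (a_smooth i) Up) IH big_cons.
Qed.

Lemma nabla_sum_r U (I : Type) (r : seq I) (a : I -> M -> R) X (Y : I ->
  vfield M) p :
  open U -> (forall i, smooth_on U (a i)) -> vfield_smooth U X ->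
  (forall i, vfield_smooth U (Y i)) -> U p ->
  nabla X (fun q => \sum_(i <- r) a i q *: Y i q) p =
  \sum_(i <- r) (lie X (a i) p *: Y i p + a i p *: nabla X (Y i) p).
Proof.
move=> oU a_smooth Xs Ys Up; elim: r => [|i r IH].
  have -> : (fun q => \sum_(i <- [::]) a i q *: Y i q) = (fun=> 0).
    by apply/funext => q; rewrite big_nil.
  by rewrite big_nil; exact: (nabla0r oU Xs Up).
have -> : (fun q => \sum_(j <- i :: r) a j q *: Y j q) =
    (fun q => a i q *: Y i q + \sum_(j <- r) a j q *: Y j q).
  by apply/funext => q; rewrite big_cons.
have Ss := vfield_smooth_sum r oU a_smooth Ys.
by rewrite (nabla_leibniz nablaP oU Xs (Ys i) Ss (a_smooth i) Up) IH big_cons.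
Qed.

Lemma field_expansion c p (u : tangent p) : dom c p ->
  u = \sum_i coords c u 0 i *: const_field c (delta_mx 0 i) p :> 'rV[R]_n.
Proof.
move=> cp; rewrite -[LHS](const_field_coords u cp).
by rewrite [in LHS](row_sum_delta (coords c u)) const_field_sum.
Qed.

Lemma const_field_expansion c p (u : 'rV[R]_n) : dom c p ->
  const_field c u p = \sum_i u 0 i *: const_field c (delta_mx 0 i) p.
Proof. by move=> cp; rewrite [in LHS](row_sum_delta u) const_field_sum. Qed.

Lemma coords_entry_smooth U c X i : open U -> vfield_smooth U X ->
  smooth_on (U `&` dom c) (fun q => coords c (X q : tangent q) 0 i).
Proof.
move=> oU Xs; apply: smooth_on_entry; last exact: Xs.
by apply: openI => //; exact: dom_open.
Qed.

Lemma nabla_expand_l U c X Y p : open U -> vfield_smooth U X ->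
  vfield_smooth U Y ->
  U p -> dom c p ->
  nabla X Y p =
  \sum_i coords c (X p : tangent p) 0 i *: nabla (const_field c
    (delta_mx 0 i)) Y p.
Proof.
move=> oU Xs Ys Up cp.
have oUc : open (U `&` dom c) by apply: openI => //; exact: dom_open.
have subl : U `&` dom c `<=` U by exact: subIsetl.
have as_ i := coords_entry_smooth c i oU Xs.
have Es i : vfield_smooth (U `&` dom c) (const_field c (delta_mx 0 i)).
  exact: vfield_smooth_subset (const_field_smooth c _).
have Ys' := vfield_smooth_subset subl Ys.
rewrite -(nabla_sum_l (index_enum _) oUc as_ Es Ys' (conj Up cp)).
have Ss := vfield_smooth_sum (index_enum _) oUc as_ Es.
apply: (nabla_local oUc Ss Ys' _ _ (conj Up cp)); last by [].
by move=> q [Uq cq]; exact: field_expansion.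
Qed.

(** Both sides expand in the coordinate fields with the same coefficients at p. *)
Lemma nabla_tensorial U X X' Y p : open U -> vfield_smooth U X ->
  vfield_smooth U X' -> vfield_smooth U Y -> U p -> X p = X' p ->
  nabla X Y p = nabla X' Y p.
Proof.
move=> oU Xs Xs' Ys Up XX'.
rewrite (nabla_expand_l oU Xs Ys Up (dom_chart_at p)).
by rewrite (nabla_expand_l oU Xs' Ys Up (dom_chart_at p)) XX'.
Qed.

Lemma nabla_const_sum_r c p u (I : Type) (r : seq I) (a : I -> R) (v : I ->
  'rV[R]_n) :
  dom c p ->
  nabla (const_field c u) (const_field c (\sum_(i <- r) a i *: v i)) p =
  \sum_(i <- r) a i *: nabla (const_field c u) (const_field c (v i)) p.
Proof.
move=> cp; have oc := dom_open c; have us := const_field_smooth c u.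
have vs i := const_field_smooth c (v i).
transitivity (nabla (const_field c u) (fun q =>
  \sum_(i <- r) a i *: const_field c (v i) q) p).
  have Ss := vfield_smooth_sum (a := fun i _ => a i) r oc
    (fun i => smooth_on_cst _ (a i)) vs.
  apply: (nabla_local oc us Ss _ _ cp); first by [].
  by move=> q cq; rewrite const_field_sum.
rewrite (nabla_sum_r (a := fun i _ => a i) r oc (fun i =>
  smooth_on_cst _ (a i)) us vs cp).
apply: eq_bigr => i _; rewrite /lie /tdiff.
rewrite -[(fun=> a i) \o _]/(fun=> a i) derive_cst scale0r add0r //.
Qed.

End Connections.

(** * Covariant derivatives along curves *)

Section Curves.
Context {R : realType} {n : nat} {M : manifold R n}.
Implicit Types (c d e : chart M) (p : M) (U : set M) (W : normedModType R).
Implicit Types (X Y Z : vfield M) (gam : R -> M).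

Definition curve_differentiable gam (t : R) : Prop :=
  {for t, continuous gam} /\ derivable (phi (chart_at (gam t)) \o gam) t 1.

Lemma curve_near_dom gam (t : R) c : {for t, continuous gam} -> dom c (gam t) ->
  \forall s \near t, dom c (gam s).
Proof. by move=> cg cp; apply: cg; apply: open_nbhs_nbhs; split=> //;
  exact: dom_open. Qed.

Lemma curve_derive W (F : M -> W) gam (t : R) :
  curve_differentiable gam t -> rep_differentiable F (gam t) ->
  is_derive t 1 (F \o gam) (tdiff F (velocity gam t : tangent (gam t))).
Proof.
move=> [cg dg] dF; have cp := dom_chart_at (gam t).
have := is_derive_comp (dF _ cp) (derivableP dg).
rewrite -(deriveE _ (dF _ cp)); apply: near_eq_is_derive.
by apply: filterS (curve_near_dom cg cp) => s cs; rewrite /= phiK.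
Qed.

Lemma curve_in_chart c (x : R -> 'rV[R]_n) (t : R) :
  (phi c @` dom c) (x t) -> derivable x t 1 ->
  curve_differentiable (psi c \o x) t /\
  velocity (psi c \o x) t = const_field c ('D_1 x t) (psi c (x t)).
Proof.
move=> xt dx; have [cp xE] := img1P xt.
have cx : {for t, continuous x}.
  exact/differentiable_continuous/derivable1_diffP.
have cg : {for t, continuous (psi c \o x)}.
  by apply: continuous_comp => //; exact: psi_continuous.
have dT : differentiable (phi (chart_at (psi c (x t))) \o psi c) (x t).
  rewrite -[in X in differentiable _ X]xE;
    apply: transition_differentiable => //.
  exact: dom_chart_at.
have [d1 d2] := is_derive_comp dT (derivableP dx).
split; first by split.
by apply: etrans d2 _; rewrite -deriveE// const_fieldE /Jac xE.
Qed.

Section CovariantDerivative.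
Variable nabla : vfield M -> vfield M -> vfield M.
Hypothesis nablaP : is_connection nabla.

Lemma cov_along_near gam (V V' : R -> 'rV[R]_n) (t : R) :
  (\forall s \near t, V s = V' s) ->
    cov_along nabla gam V t = cov_along nabla gam V' t.
Proof.
move=> VV'; have V0 : V t = V' t := nbhs_singleton VV'.
have dE : 'D_1 (fun s => coords (chart_at (gam t)) (V s : tangent (gam s))) t =
    'D_1 (fun s => coords (chart_at (gam t)) (V' s : tangent (gam s))) t.
  by apply: near_eq_derive; apply: filterS VV' => s ->.
by rewrite /cov_along V0 dE.
Qed.

(** Leibniz rule along a curve. The Z i are fields along the curve and not
    restrictions of fields on M, so that it also applies to the images of
    tangent fields under an immersion. *)
Lemma cov_along_sum gam (t : R) (I : Type) (r : seq I) (a : I -> R ->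
  R) (da : I -> R)
    (Z : I -> R -> 'rV[R]_n) :
  {for t, continuous gam} ->
  (forall i, is_derive t 1 (a i) (da i)) ->
  (forall i, derivable (fun s =>
    coords (chart_at (gam t)) (Z i s : tangent (gam s))) t 1) ->
  cov_along nabla gam (fun s => \sum_(i <- r) a i s *: Z i s) t =
  \sum_(i <- r) (da i *: Z i t + a i t *: cov_along nabla gam (Z i) t).
Proof.
move=> cg a_da dZ; set c := chart_at (gam t) in dZ *.
have cp : dom c (gam t) by exact: dom_chart_at.
pose zi i s := coords c (Z i s : tangent (gam s)).
have dsum : is_derive t 1 (fun s =>
  coords c (\sum_(i <- r) a i s *: Z i s : tangent (gam s)))
    (\sum_(i <- r) (a i t *: 'D_1 (zi i) t + da i *: zi i t)).
  have dS : is_derive t 1 (fun s => \sum_(i <- r) a i s *: zi i s)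
      (\sum_(i <- r) (a i t *: 'D_1 (zi i) t + da i *: zi i t)).
    apply: is_derive_sum_seq => i.
    by apply: is_derive_scale => //; exact: (derivableP (dZ i)).
  apply: near_eq_is_derive dS.
  apply: filterS (curve_near_dom cg cp) => s cs.
  by rewrite coordsE Jac_sum//; exact: dom_chart_at.
have [_ dsumE] := dsum.
rewrite {1}/cov_along /cov dsumE (nabla_const_sum_r nablaP)// -big_split /=.
apply: eq_bigr => i _.
have ziE : zi i t = Z i t by rewrite /zi coords_self.
rewrite /cov_along /cov -/(zi i) ziE -/c.
move: (nabla _ _ _) => A1.
by rewrite scalerDr [RHS]addrA [da i *: _ + _]addrC.
Qed.

(** The formula defining [cov] uses the coordinate fields of the preferred chart
    at gam t. Expanding Y in these fields, whose values at gam t form the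
    standard basis, the Leibniz rule for nabla produces the same two terms. *)
Lemma cov_along_field gam (t : R) U X Y : curve_differentiable gam t ->
  open U ->
  vfield_smooth U X -> vfield_smooth U Y -> U (gam t) ->
    X (gam t) = velocity gam t ->
  cov_along nabla gam (Y \o gam) t = nabla X Y (gam t).
Proof.
move=> dg oU Xs Ys Up XE; rewrite /cov_along /cov.
set c := chart_at (gam t); have cp : dom c (gam t) by exact: dom_chart_at.
have oUc : open (U `&` dom c) by apply: openI => //; exact: dom_open.
have subl : U `&` dom c `<=` U by exact: subIsetl.
have subr' : U `&` dom c `<=` dom c by exact: subIsetr.
have Upc : (U `&` dom c) (gam t) by [].
have rep : rep_differentiable (fun q => coords c (Y q : tangent q)) (gam t).
  exact: smooth_on_rep oUc (Ys c) Upc.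
have [_ ->] := curve_derive dg rep.
pose a i q := coords c (Y q : tangent q) 0 i.
have as_ i : smooth_on (U `&` dom c) (a i) := coords_entry_smooth c i oU Ys.
pose E i := const_field c (delta_mx 0 i : 'rV[R]_n).
have Es i : vfield_smooth (U `&` dom c) (E i).
  exact: vfield_smooth_subset (const_field_smooth c _).
have Xs' := vfield_smooth_subset subl Xs.
have Ss := vfield_smooth_sum (index_enum _) oUc as_ Es.
have -> : nabla X Y (gam t) = nabla X (fun q => \sum_i a i q *: E i q) (gam t).
  apply: (nabla_local nablaP oUc Xs' Ss _ _ Upc); first by [].
  by move=> q [Uq cq]; exact: field_expansion.
rewrite (nabla_sum_r nablaP (index_enum _) oUc as_ Xs' Es Upc) big_split /=.
congr (_ + _).
  have Ei i : E i (gam t) = delta_mx 0 i.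
    by rewrite /E const_fieldE Jac_id.
  rewrite [LHS]row_sum_delta; apply: eq_bigr => i _; rewrite Ei; congr (_ *: _).
  rewrite /lie /tdiff XE.
  have dY := rep _ cp.
  have := derive_mx (diff_derivable (v := velocity gam t) dY).
  by move=> /(congr1 (fun A : 'rV[R]_n => A 0 i)); rewrite mxE.
have YE : Y (gam t) = \sum_i a i (gam t) *: (delta_mx 0 i : 'rV[R]_n).
  by rewrite -row_sum_delta /a coords_self.
rewrite {1}YE (nabla_const_sum_r nablaP)//.
apply: eq_bigr => i _; congr (_ *: _).
apply: (nabla_tensorial nablaP oUc _ Xs' (Es i) Upc).
  exact: vfield_smooth_subset (const_field_smooth c _).
by rewrite XE const_fieldE Jac_id.
Qed.

End CovariantDerivative.
End Curves.

(** * Curves and fields given by components in one chart *)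

Section ChartCurves.
Context {R : realType} {n : nat} {M : manifold R n}.
Variables (c : chart M) (I : set R) (x : R -> 'rV[R]_n).
Hypothesis I_open : open I.
Hypothesis x_smooth : smooth I x.
Hypothesis x_img : forall t, I t -> (phi c @` dom c) (x t).

(** The field along psi c o x with components v in the chart c. Its values are
    expressed in the preferred chart of the current point, which may jump along
    the curve; all smoothness is therefore read off from v and x. *)
Definition chart_lift (v : R -> 'rV[R]_n) : R -> 'rV[R]_n :=
  fun t => const_field c (v t) (psi c (x t)).

Lemma x_derivable (t : R) : I t -> derivable x t 1.
Proof. by move=> It; exact: Ck_derivable (x_smooth 1%N) It. Qed.

Lemma curve_dom t : I t -> dom c (psi c (x t)).
Proof. by move=> It; case: (img1P (x_img It)). Qed.

Lemma phi_curve t : I t -> phi c (psi c (x t)) = x t.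
Proof. by move=> It; case: (img1P (x_img It)). Qed.

Lemma chart_curve_differentiable (t : R) : I t ->
  curve_differentiable (psi c \o x) t.
Proof. by move=> It; case: (curve_in_chart (x_img It) (x_derivable It)). Qed.

Lemma chart_curve_velocity (t : R) : I t ->
  velocity (psi c \o x) t = chart_lift ('D_1 x) t.
Proof. by move=> It; case: (curve_in_chart (x_img It) (x_derivable It)). Qed.

Lemma near_I (t : R) : I t -> \forall s \near t, I s.
Proof. by move=> It; apply: open_nbhs_nbhs. Qed.

Lemma curve_preimage_open (d : chart M) : open (I `&` (psi c \o x) @^-1` dom d).
Proof.
rewrite openE => t [It dt]; apply: filterI; first exact: near_I.
apply: (chart_curve_differentiable It).1.
by apply: open_nbhs_nbhs; split=> //; exact: dom_open.
Qed.

Lemma curve_preimage_img (d : chart M) t : (I `&` (psi c \o x) @^-1` dom d) t ->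
  (phi c @` (dom c `&` dom d)) (x t).
Proof.
move=> [It dt]; apply/imgP; split=> //;
  [exact: x_img|exact: curve_dom|exact: phi_curve].
Qed.

Lemma chart_curve_smooth : curve_smooth I (psi c \o x).
Proof.
split=> [t It|d k]; first exact: (chart_curve_differentiable It).1.
apply: (@Ck_comp _ _ _ _ _ _ _ (phi c @` (dom c `&` dom d)) x (phi d \o psi c)).
- exact: curve_preimage_open.
- exact/img_openI/dom_open.
- exact: curve_preimage_img.
- by apply: Ck_subset (x_smooth k) => t [].
- exact: transition_smooth.
Qed.

Lemma lift_smooth v : smooth I v -> along_smooth I (psi c \o x) (chart_lift v).
Proof.
move=> vs d k; set U := I `&` _.
have oU : open U by exact: curve_preimage_open.
have xU t : U t -> (phi c @` (dom c `&` dom d)) (x t)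
  by exact: curve_preimage_img.
have oU' : open (phi c @` (dom c `&` dom d)) by exact/img_openI/dom_open.
have sub : U `<=` I by move=> t [].
pose T := phi d \o psi c.
apply: (@Ck_eq _ _ _ _ _
  (fun t => \sum_i \sum_j v t i j *: ('D_(delta_mx i j) T \o x) t)) => //.
  move=> t Ut; have [It dt] := Ut.
  rewrite /chart_lift coords_const_field2//; last exact: curve_dom.
  rewrite Jac_diff//; last exact: curve_dom.
  rewrite phi_curve// diff_mxE//.
  have := transition_differentiable (curve_dom It) dt; rewrite phi_curve//.
do 2 apply: Ck_sum => // ?.
apply: CkZ => //; first exact/(Ck_entry _ _ oU)/(Ck_subset sub (vs k)).
apply: (Ck_comp oU oU' xU); first exact: Ck_subset sub (x_smooth k).
exact: (Ck_derive _ (transition_smooth c d k.+1)).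
Qed.

Lemma lift_expansion v t : I t ->
  chart_lift v t = \sum_i v t 0 i *: const_field c (delta_mx 0 i) (psi c (x t)).
Proof. by move=> It; apply: const_field_expansion; exact: curve_dom. Qed.

Lemma lift_linear (a b : R) (u v : R -> 'rV[R]_n) t : I t ->
  chart_lift (fun s => a *: u s + b *: v s) t =
    a *: chart_lift u t + b *: chart_lift v t.
Proof.
move=> It; have cp := curve_dom It.
pose L y : 'rV[R]_n := const_field c y (psi c (x t)).
have LP r y z : L (r *: y + z) = r *: L y + L z by exact: const_fieldP.
have L0 : L 0 = 0 by exact: const_field0.
change (L (a *: u t + b *: v t) = a *: L (u t) + b *: L (v t)).
move: L LP L0 => L LP L0.
by rewrite LP -[b *: v t]addr0 LP L0 addr0.
Qed.

Lemma derive_entry (v : R -> 'rV[R]_n) (t : R) i : derivable v t 1 ->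
  is_derive t 1 (fun s => v s 0 i) ('D_1 v t 0 i).
Proof.
move=> dv; rewrite derive_mx// mxE; apply: derivableP.
by apply/(derivable_mxP v t 1).1.
Qed.

Section Covariant.
Variable nabla : vfield M -> vfield M -> vfield M.
Hypothesis nablaP : is_connection nabla.

Lemma cov_along_lift v (t : R) : I t -> derivable v t 1 ->
  cov_along nabla (psi c \o x) (chart_lift v) t =
  \sum_i ('D_1 v t 0 i *: const_field c (delta_mx 0 i) (psi c (x t)) +
    v t 0 i *: nabla (const_field c ('D_1 x t)) (const_field c (delta_mx 0 i))
      (psi c (x t))).
Proof.
move=> It dv; have cp := curve_dom It.
have dg := chart_curve_differentiable It.
pose E i : vfield M := const_field c (delta_mx 0 i : 'rV[R]_n).
rewrite (@cov_along_near _ _ _ nabla _ _ (fun s =>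
  \sum_i v s 0 i *: (E i \o (psi c \o x)) s)).
  rewrite (cov_along_sum nablaP (index_enum _) (a := fun i s => v s 0 i) dg.1
    (fun i => derive_entry i dv)).
    apply: eq_bigr => i _; congr (_ + _ *: _).
    apply: (cov_along_field nablaP dg (dom_open c)) => //;
      first exact: const_field_smooth.
      exact: const_field_smooth.
    by rewrite chart_curve_velocity.
  move=> i.
  have rep : rep_differentiable (fun q =>
    coords (chart_at (psi c (x t))) (E i q : tangent q)) (psi c (x t)).
    apply: (smooth_on_rep _ (const_field_smooth c _ _)); last by split=> //;
      exact: dom_chart_at.
    by apply: openI; exact: dom_open.
  by case: (curve_derive dg rep).
by apply: filterS (near_I It) => s Is; exact: lift_expansion.
Qed.

(** The bilinear term Gamma(u, v) at the point y of the chart c; u is the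
    velocity and v the differentiated field. *)
Definition christoffel (u v : 'rV[R]_n) (y : 'rV[R]_n) : 'rV[R]_n :=
  \sum_i \sum_j (v 0 i * u 0 j) *:
    coords c (nabla (const_field c (delta_mx 0 j)) (const_field c
      (delta_mx 0 i))
      (psi c y) : tangent (psi c y)).

Lemma christoffel_sumr (u y : 'rV[R]_n) (J : Type) (r : seq J)
    (a : J -> R) (v : J -> 'rV[R]_n) :
  christoffel u (\sum_(k <- r) a k *: v k) y =
  \sum_(k <- r) a k *: christoffel u (v k) y.
Proof.
elim: r => [|k r IH].
  rewrite !big_nil /christoffel big1// => i _; rewrite big1// => j _.
  by rewrite mxE mul0r scale0r.
rewrite !big_cons -{}IH; move: (\sum_(j <- r) _) => z.
rewrite /christoffel scaler_sumr -big_split /=; apply: eq_bigr => i _.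
rewrite scaler_sumr -big_split /=; apply: eq_bigr => j _.
by rewrite !mxE mulrDl scalerDl scalerA mulrA.
Qed.

Lemma cov_along_lift_christoffel v (t : R) : I t -> derivable v t 1 ->
  cov_along nabla (psi c \o x) (chart_lift v) t =
  chart_lift (fun s => 'D_1 v s + christoffel ('D_1 x s) (v s) (x s)) t.
Proof.
move=> It dv; have cp := curve_dom It.
rewrite cov_along_lift// /chart_lift -[X in const_field c
  (X + _)]scale1r const_fieldP//.
rewrite scale1r big_split /= -const_field_expansion//; congr (_ + _).
have -> : christoffel ('D_1 x t) (v t) (x t) =
    \sum_i v t 0 i *: \sum_j 'D_1 x t 0 j *:
    coords c (nabla (const_field c (delta_mx 0 j)) (const_field c
      (delta_mx 0 i))
      (psi c (x t)) : tangent (psi c (x t))).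
  apply: eq_bigr => i _; rewrite scaler_sumr.
  by apply: eq_bigr => j _; rewrite scalerA.
rewrite const_field_sum//; apply: eq_bigr => i _; congr (_ *: _).
rewrite const_field_sum//.
rewrite (nabla_expand_l nablaP (dom_open c) (const_field_smooth c _)
  (const_field_smooth c _) cp cp).
apply: eq_bigr => j _; rewrite coords_const_field//; congr (_ *: _).
by rewrite const_field_coords.
Qed.

End Covariant.

Section Metric.
Variables (q : nat) (g : metric M q) (nabla : vfield M -> vfield M -> vfield M).
Hypothesis nablaP : is_levi_civita g nabla.
Local Notation ip t := (bform (gram g (psi c (x t)))).

Lemma metric_rep_smooth i j : smooth_on (dom c) (fun p =>
  bform (gram g p) (const_field c (delta_mx 0 i) p) (const_field c
    (delta_mx 0 j) p) : R).
Proof.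
by apply: gram_smooth; [exact: dom_open|exact: const_field_smooth|exact:
  const_field_smooth].
Qed.

(** Compatibility with the metric holds for coordinate fields, and both sides
    follow the Leibniz rule in the components v and w. *)
Lemma is_derive_inner v w (t : R) : I t -> derivable v t 1 -> derivable w t 1 ->
  is_derive t 1 (fun s => ip s (chart_lift v s) (chart_lift w s))
    (ip t (cov_along nabla (psi c \o x) (chart_lift v) t) (chart_lift w t) +
     ip t (chart_lift v t) (cov_along nabla (psi c \o x) (chart_lift w) t)).
Proof.
move=> It dv dw; have cp := curve_dom It.
have dg := chart_curve_differentiable It.
have nablaC := lc_connection nablaP.
pose E i : vfield M := const_field c (delta_mx 0 i : 'rV[R]_n).
pose G i j p : R := bform (gram g p) (E i p) (E j p).
pose X : vfield M := const_field c ('D_1 x t).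
pose p := psi c (x t).
have dG i j : is_derive t 1 (G i j \o (psi c \o x))
    (bform (gram g p) (nabla X (E i) p) (E j p) + bform (gram g p) (E i p)
      (nabla X (E j) p)).
  have rep := smooth_on_rep (dom_open c) (metric_rep_smooth i j) cp.
  have := curve_derive dg rep; rewrite chart_curve_velocity//.
  have := lc_metric nablaP (dom_open c) (const_field_smooth c ('D_1 x t))
    (const_field_smooth c (delta_mx 0 i)) (const_field_smooth c
      (delta_mx 0 j)) cp.
  by rewrite /lie /inner => ->.
have bform_sum (A : 'M[R]_n) (a b : 'I_n -> R) (u w' : 'I_n -> 'rV[R]_n) :
    bform A (\sum_i a i *: u i) (\sum_j b j *: w' j) =
    \sum_i \sum_j (a i * b j) * bform A (u i) (w' j).
  rewrite /bform mulmx_suml mulmx_suml summxE; apply: eq_bigr => i _.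
  rewrite linear_sum mulmx_sumr summxE; apply: eq_bigr => j _.
  by rewrite -[LHS]/(bform A (a i *: u i) (b j *: w' j)) bformZl bformZr mulrA.
have dS : is_derive t 1 (fun s =>
  \sum_i \sum_j (v s 0 i * w s 0 j) *: G i j (psi c (x s)))
  (\sum_i \sum_j ((v t 0 i * w t 0 j) *: (bform (gram g p) (nabla X (E i) p)
    (E j p) +
      bform (gram g p) (E i p) (nabla X (E j) p)) +
    (v t 0 i *: 'D_1 w t 0 j + 'D_1 v t 0 i *: w t 0 j) *: G i j p)).
  apply: is_derive_sum_seq => i; apply: is_derive_sum_seq => j.
  exact: (is_derive_scale (is_derive_scale (derive_entry i dv)
    (derive_entry j dw)) (dG i j)).
apply: (@near_eq_is_derive _ _ _ (fun s =>
  \sum_i \sum_j (v s 0 i * w s 0 j) *: G i j (psi c (x s)))).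
  apply: filterS (near_I It) => s Is.
  by rewrite [chart_lift v s]lift_expansion// [chart_lift w s]lift_expansion//
    bform_sum.
apply: is_derive_eq dS _.
rewrite !cov_along_lift// -/p -/X.
rewrite [chart_lift v t]lift_expansion// [chart_lift w t]lift_expansion// -/p.
rewrite !big_split /= !bformDl !bformDr !bform_sum.
rewrite -!big_split /=; apply: eq_bigr => i _.
rewrite -!big_split /=; apply: eq_bigr => j _.
rewrite -/(E i) -/(E j) /G.
rewrite -![_ *: _]/(_ * _); ring.
Qed.

End Metric.
End ChartCurves.

(** * The Gauss formula along a curve *)

Section Immersions.
Context {R : realType} {n m : nat} {M : manifold R n} {M' : manifold R m}.
Variable f : M -> M'.
Hypothesis f_smooth : map_smooth f.

Lemma preimage_open (U : set M') : open U -> open (f @^-1` U).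
Proof. by move=> oU; apply: open_comp => // p _; exact: f_smooth.1. Qed.

Lemma map_rep (d : chart M') p : dom d (f p) ->
  rep_differentiable (phi d \o f) p.
Proof.
move=> dp; apply: (smooth_on_rep _ (f_smooth.2 d)) => //.
exact/preimage_open/dom_open.
Qed.

Lemma tdiffP (W : normedModType R) (F : M -> W) p (a : R) (u v : tangent p) :
  rep_differentiable F p ->
  tdiff F (a *: u + v : tangent p) = a *: tdiff F u + tdiff F v.
Proof.
move=> dF; have dF0 := dF _ (dom_chart_at p).
by rewrite /tdiff !deriveE// linearP.
Qed.

Lemma dmapP p (a : R) (u v : tangent p) :
  dmap f (a *: u + v : tangent p) = a *: dmap f u + dmap f v.
Proof. by rewrite /dmap tdiffP//; apply: map_rep; exact: dom_chart_at. Qed.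

Lemma dmap0 p : dmap f (0 : tangent p) = 0.
Proof. by rewrite /dmap /tdiff derive0. Qed.

Lemma dmap_sum p (I : Type) (r : seq I) (a : I -> R) (u : I -> tangent p) :
  dmap f (\sum_(i <- r) a i *: (u i : 'rV[R]_n) : tangent p) =
  \sum_(i <- r) a i *: (dmap f (u i) : 'rV[R]_m).
Proof.
elim: r => [|i r IH]; first by rewrite !big_nil dmap0.
by rewrite !big_cons dmapP IH.
Qed.

Lemma dmapD p (u v : tangent p) :
  dmap f ((u : 'rV[R]_n) + v : tangent p) = (dmap f u : 'rV[R]_m) + dmap f v.
Proof. by rewrite -[u : 'rV[R]_n]scale1r dmapP !scale1r. Qed.

(** [dmap] takes components in the preferred chart at f p; any chart around f p
    gives the same vector. *)
Lemma coords_dmap (d : chart M') p (u : tangent p) : dom d (f p) ->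
  coords d (dmap f u) = tdiff (phi d \o f) u.
Proof.
move=> dp; set d' := chart_at (f p);
  have d'p : dom d' (f p) by exact: dom_chart_at.
have cp := dom_chart_at p.
have dF : differentiable (phi d' \o f \o psi (chart_at p)) (phi (chart_at p) p).
  exact: map_rep.
have pE : phi d' (f p) = (phi d' \o f \o psi (chart_at p)) (phi (chart_at p) p).
  by rewrite /= phiK.
have dT : differentiable (phi d \o psi d') (phi d' (f p)).
  exact: transition_differentiable.
have dT' := dT; rewrite pE in dT'.
have [_ cE] := is_derive_comp dT' (derivableP (diff_derivable (v := u) dF)).
have e1 : coords d (dmap f u) =
  'D_('D_u (phi d' \o f \o psi (chart_at p)) (phi (chart_at p) p))
    (phi d \o psi d') (phi d' (f p)) by [].
rewrite {}e1 {1}pE (deriveE _ dT') -cE.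
apply: near_eq_derive.
have : \forall y \near phi (chart_at p) p, dom d' (f (psi (chart_at p) y)).
  have : nbhs (phi (chart_at p) p) (phi (chart_at p) @` (dom
    (chart_at p) `&` f @^-1` dom d')).
    apply: open_nbhs_nbhs; split; last by exists p.
    exact/img_openI/preimage_open/dom_open.
  by apply: filterS => y /imgP[].
by apply: filterS => y dy /=; rewrite phiK.
Qed.

Lemma dmap_const_field_smooth (c : chart M) (d : chart M') u :
  smooth_on (dom c `&` f @^-1` dom d)
    (fun r => coords d (dmap f (const_field c u r : tangent r))).
Proof.
have od : open (f @^-1` dom d) by exact/preimage_open/dom_open.
have oU : open (dom c `&` f @^-1` dom d) by apply: openI => //; exact: dom_open.
apply: (@smooth_on_eq _ _ _ _ _ ('D_u (phi d \o f \o psi c) \o phi c)) => //.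
  move=> p [cp dp]; rewrite coords_dmap// tdiff_const_field//; exact: map_rep.
move=> e k.
apply: (@Ck_comp _ _ _ _ _ _ _ (phi c @` (dom c `&` f @^-1` dom d))
   (phi c \o psi e) ('D_u (phi d \o f \o psi c))).
- exact: img_openI.
- exact: img_openI.
- by move=> y /imgP[_ _ [cy dy] _] /=; exists (psi e y).
- apply: Ck_subset (transition_smooth e c k) => _ [q [eq [cq dq]] <-].
  by exists q.
- exact: (Ck_derive u (f_smooth.2 d c k.+1)).
Qed.

Lemma curve_map gam (t : R) : curve_differentiable gam t ->
  curve_differentiable (f \o gam) t /\
  velocity (f \o gam) t = dmap f (velocity gam t : tangent (gam t)).
Proof.
move=> dg; have := curve_derive dg (map_rep (dom_chart_at (f (gam t)))).
move=> [d1 d2]; split; last by [].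
split; last by [].
by apply: continuous_comp; [exact: dg.1|exact: f_smooth.1].
Qed.

Lemma cov_along_map nabla' gam (t : R) (X : vfield M) (Z : M -> 'rV[R]_m) :
  curve_differentiable gam t -> X (gam t) = velocity gam t ->
  rep_differentiable (fun r =>
    coords (chart_at (f (gam t))) (Z r : tangent (f r))) (gam t) ->
  cov_along nabla' (f \o gam) (Z \o gam) t = cov_map nabla' f X Z (gam t).
Proof.
move=> dg XE dZ; have [_ vE] := curve_map dg; have [_ zE] := curve_derive dg dZ.
have -> : cov_map nabla' f X Z (gam t) = cov nabla' (f (gam t))
    (dmap f (velocity gam t : tangent (gam t))) (Z (gam t))
    (tdiff (fun r => coords (chart_at (f (gam t))) (Z r : tangent (f r)))
      (velocity gam t : tangent (gam t))).
  by rewrite /cov_map XE.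
rewrite -zE -vE; reflexivity.
Qed.

Variables (c : chart M) (I : set R) (x : R -> 'rV[R]_n).
Hypothesis I_open : open I.
Hypothesis x_smooth : smooth I x.
Hypothesis x_img : forall t, I t -> (phi c @` dom c) (x t).
Variables (q q' : nat) (g : metric M q) (g' : metric M' q').
Variables (nabla : vfield M -> vfield M -> vfield M).
Variables (nabla' : vfield M' -> vfield M' -> vfield M').
Hypothesis nablaP : is_connection nabla.
Hypothesis nablaP' : is_connection nabla'.
Variables (B : tensor_along f) (H : forall p : M, tangent (f p)).
Hypothesis B_sff : is_second_fundamental_form g' nabla nabla' B.
Hypothesis B_umbilical : totally_umbilical g B H.

(** The Gauss formula applies to coordinate fields of M. A field along the curve
    is a combination of these with variable coefficients, and both sides obey
    the Leibniz rule. *)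
Lemma gauss_along v (t : R) : I t -> derivable v t 1 ->
  let gam := psi c \o x in
  cov_along nabla' (f \o gam) (fun s =>
    dmap f (chart_lift c x v s : tangent (gam s))) t =
  dmap f (cov_along nabla gam (chart_lift c x v) t : tangent (gam t)) +
  inner g (velocity gam t : tangent (gam t)) (chart_lift c x v t) *: (H
    (gam t) : 'rV[R]_m).
Proof.
move=> It dv gam; have cp : dom c (gam t) := curve_dom x_img It.
have dg := chart_curve_differentiable x_smooth x_img It.
have vE := chart_curve_velocity x_smooth x_img It.
have [dfg _] := curve_map dg.
pose E i : vfield M := const_field c (delta_mx 0 i : 'rV[R]_n).
pose X : vfield M := const_field c ('D_1 x t).
have XE : X (gam t) = velocity gam t by rewrite vE.
pose Z i (r : M) : 'rV[R]_m := dmap f (E i r : tangent r).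
have Z_rep i : rep_differentiable
    (fun r => coords (chart_at (f (gam t))) (Z i r : tangent (f r))) (gam t).
  apply: smooth_on_rep (dmap_const_field_smooth c _ _) _.
    by apply: openI; [exact: dom_open|exact/preimage_open/dom_open].
  by split=> //; exact: dom_chart_at.
rewrite (@cov_along_near _ _ _ nabla' _ _ (fun s =>
  \sum_i v s 0 i *: (Z i \o gam) s)); last first.
  apply: filterS (near_I I_open It) => s Is.
  by rewrite (lift_expansion x_img _ Is) dmap_sum.
have ZD i : derivable (fun s =>
  coords (chart_at ((f \o gam) t)) ((Z i \o gam) s :
    tangent ((f \o gam) s))) t 1.
  by case: (curve_derive dg (Z_rep i)).
rewrite (cov_along_sum nablaP' (index_enum _) (a := fun i s => v s 0 i) dfg.1
    (fun i => derive_entry i dv) ZD).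
have gauss i : cov_along nabla' (f \o gam) (Z i \o gam) t =
    dmap f (nabla X (E i) (gam t) : tangent (gam t)) +
    inner g (velocity gam t : tangent (gam t)) (E i (gam t)) *: (H (gam t) :
      'rV[R]_m).
  rewrite (cov_along_map nabla' dg XE (Z_rep i)).
  have sg : cov_map nabla' f X (Z i) (gam t) =
    dmap f (nabla X (E i) (gam t) : tangent (gam t)) +
      B (X (gam t) : tangent (gam t)) (E i (gam t)).
    exact: (sff_gauss B_sff (dom_open c) (const_field_smooth c _)
      (const_field_smooth c _) cp).
  by rewrite sg B_umbilical XE.
rewrite (cov_along_lift I_open x_smooth x_img nablaP It dv) -/gam -/X.
rewrite [X in dmap f X + _]big_split /= dmapD !dmap_sum
  (lift_expansion x_img v It) -/gam /inner bform_sumr.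
rewrite scaler_suml -!big_split /=; apply: eq_bigr => i _.
by rewrite gauss scalerDr scalerA addrA.
Qed.

End Immersions.

(** * Moving frames with prescribed constant curvatures *)

Section LinearUniqueness.
Context {R : realType}.

(** On an interval of half-length 1/(2C), where C bounds L, the maximum of |E| is
    at most half of itself. *)
Lemma linear_ode_zero m n (L : {linear 'M[R]_(m, n) -> 'M[R]_(m, n)}) (a : R) :
  0 < a -> exists2 b : R, 0 < b <= a &
  forall E : R -> 'M[R]_(m, n), E 0 = 0 ->
    (forall t : R, `|t| < a -> is_derive t 1 E (L (E t))) ->
    forall t : R, `|t| < b -> E t = 0.
Proof.
move=> a0; have [C C0 LC] := linear_lipschitz (@linear_mx_continuous _ _ _ _ L).
pose b := Num.min a (2 * C)^-1.
have b0 : 0 < b by rewrite lt_min a0 invr_gt0 mulr_gt0.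
have ba : b <= a by rewrite ge_min lexx.
have bC : C * b <= 2^-1.
  have C2 : 0 < 2 * C by rewrite mulr_gt0.
  have : b * (2 * C) <= 1.
    by rewrite -ler_pdivlMr// div1r /b ge_min lexx orbT.
  lra.
exists b => [|E E0 dE t tb]; first by rewrite b0 ba.
have t_a (s : R) : `|s| <= `|t| -> `|s| < a.
  by move=> st; apply: le_lt_trans st _; exact: lt_le_trans tb ba.
have tt : - `|t| <= `|t| by have := normr_ge0 t; lra.
have [|s0 _ s0_max] := @EVT_max R (fun s => `|E s|) _ _ tt.
  apply: continuous_in_subspaceT => s; rewrite inE /= in_itv /= => st.
  have sa : `|s| < a by apply: t_a; rewrite ler_norml.
  apply: (@continuous_comp _ _ _ E (fun v => `|v|));
    last exact: norm_continuous.
  by apply/differentiable_continuous/derivable1_diffP; case: (dE s sa).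
pose K := `|E s0|.
have HK k (s : R) : `|s| <= `|t| -> `|E s| <= K * (2^-1) ^+ k.
  elim: k s => [|k IH] s st.
    by rewrite expr0 mulr1; apply: s0_max; rewrite in_itv/= -ler_norml.
  have : `|E s - E 0| <= (C * (K * (2^-1) ^+ k)) * `|s - 0|.
    apply: norm_increment_abs_le => r; rewrite !subr0 => rs.
      by case: (dE r (t_a r (le_trans rs st))).
    case: (dE r (t_a r (le_trans rs st))) => _ ->.
    apply: le_trans (LC _) _; apply: ler_wpM2l; first exact: ltW.
    by apply: IH; exact: le_trans rs st.
  rewrite E0 !subr0 => /le_trans; apply.
  have Kk : 0 <= K * (2^-1) ^+ k by apply: mulr_ge0;
    [exact: normr_ge0|apply: exprn_ge0; lra].
  have -> : C * (K * 2^-1 ^+ k) * `|s| = K * 2^-1 ^+ k * (C * `|s|) by ring.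
  rewrite exprSr [leRHS]mulrA; apply: ler_wpM2l => //; apply: le_trans bC.
  by apply: ler_wpM2l; apply: ltW => //; exact: le_lt_trans st tb.
apply/eqP; rewrite -normr_le0; apply: (@le_geometric _ _ _ K) => k.
by rewrite add0r; exact: HK.
Qed.

End LinearUniqueness.

Section Frames.
Context {R : realType} {n : nat} {M : manifold R n.+1}.
Variable nabla : vfield M -> vfield M -> vfield M.
Hypothesis nablaP : is_connection nabla.

Lemma christoffel_symbol_smooth (c : chart M) i j :
  smooth (phi c @` dom c) (fun y => coords c
    (nabla (const_field c (delta_mx 0 i)) (const_field c (delta_mx 0 j))
      (psi c y)
      : tangent (psi c y))).
Proof.
move=> k.
have := nabla_smooth nablaP (dom_open c) (const_field_smooth c (delta_mx 0 i))
  (const_field_smooth c (delta_mx 0 j)).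
move=> /(_ c c k); apply: Ck_subset => _ [p cp <-].
by exists p.
Qed.

Lemma Ck_christoffel (V : normedModType R) k (U : set V) (c : chart M)
    (u v y : V -> 'rV[R]_n.+1) : open U ->
  (forall s, U s -> (phi c @` dom c) (y s)) ->
  Ck k U u -> Ck k U v -> Ck k U y ->
  Ck k U (fun s => christoffel c nabla (u s) (v s) (y s)).
Proof.
move=> oU yU uk vk yk; apply: Ck_sum => // i; apply: Ck_sum => // j.
apply: CkZ => //.
  by apply: (@CkZ _ _ _ _ _ (fun s => v s 0 i)) => //; exact: Ck_entry.
exact: (Ck_comp oU (@img_open _ _ M c) yU yk
  (@christoffel_symbol_smooth c j i k)).
Qed.

(** Position and frame are stacked in one matrix, which makes the equations a
    single autonomous system. *)
Theorem frame_ode (A : 'M[R]_n.+1) (c : chart M) (x0 : 'rV[R]_n.+1) (V0 :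
  'M[R]_n.+1) :
  (phi c @` dom c) x0 ->
  exists (a : R) (x : R -> 'rV[R]_n.+1) (V : R -> 'M[R]_n.+1),
  let I := [set t : R | `|t| < a] in
  [/\ 0 < a, x 0 = x0 /\ V 0 = V0, (forall t, I t -> (phi c @` dom c) (x t)),
    smooth I x /\ smooth I V &
    forall t : R, I t -> is_derive t 1 x (row 0 (V t)) /\
      is_derive t 1 V (A *m V t - \matrix_i christoffel c nabla (row 0 (V t))
        (row i (V t)) (x t))].
Proof.
move=> x0c.
pose X (s : 'M[R]_(1 + n.+1, n.+1)) : 'rV[R]_n.+1 := usubmx s.
pose V (s : 'M[R]_(1 + n.+1, n.+1)) : 'M[R]_n.+1 := dsubmx s.
pose F s := col_mx (row 0 (V s))
  (A *m V s - \matrix_i christoffel c nabla (row 0 (V s)) (row i (V s)) (X s)).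
pose U := [set s | (phi c @` dom c) (X s)].
have oU : open U.
  apply: open_comp; last exact: img_open.
  by move=> s _; exact: (@linear_mx_continuous _ _ _ _ usubmx).
have XU k : Ck k U X by apply: (Ck_linear_mx usubmx) => //; exact: Ck_id.
have VU k : Ck k U V by apply: (Ck_linear_mx dsubmx) => //; exact: Ck_id.
have rowU k i : Ck k U (fun s => row i (V s)) by exact: (Ck_linear_mx (row i)).
have F_smooth : smooth U F.
  move=> k; apply: Ck_col_mx => //.
  apply: CkD => //; first exact: (Ck_linear_mx (mulmx A)).
  apply: (@Ck_eq _ _ _ _ _ (fun s =>
    -1 *: \matrix_i christoffel c nabla (row 0 (V s)) (row i (V s)) (X s))) =>
      //.
    by move=> s _; rewrite scaleN1r.
  apply: CkZ => //; first exact: Ck_cst.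
  apply: Ck_mx => // i j.
  apply: (@Ck_eq _ _ _ _ _ (fun s =>
    christoffel c nabla (row 0 (V s)) (row i (V s)) (X s) 0 j)) => //.
    by move=> s _; rewrite mxE.
  by apply: Ck_entry => //; apply: Ck_christoffel.
have Us0 : U (col_mx x0 V0) by rewrite /U /= /X col_mxKu.
have [a [s [a0 s0 sU ds s_smooth]]] := smooth_ode oU F_smooth Us0.
exists a, (fun t => X (s t)), (fun t => V (s t)).
have oI : open [set t : R | `|t| < a].
  exact: open_norm_lt.
split=> //.
- by rewrite s0 /X /V col_mxKu col_mxKd.
- split=> k; first exact: (Ck_linear_mx usubmx).
  exact: (Ck_linear_mx dsubmx).
- move=> t It; split.
    have := is_derive_linear_mx usubmx (ds t It).
    by rewrite /F /= col_mxKu.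
  have := is_derive_linear_mx dsubmx (ds t It).
  by rewrite /F /= col_mxKd.
Qed.

End Frames.

Section MovingFrames.
Context {R : realType} {n : nat} {M : manifold R n.+1}.
Variables (q : nat) (g : metric M q) (nabla : vfield M -> vfield M -> vfield M).
Hypothesis nablaP : is_levi_civita g nabla.

(** The Gram matrix of the frame solves G' = A G + G A^T, as does the constant G0
    by the hypothesis on A; uniqueness makes them equal. Fields with constant
    components u in the frame are written E u, so that covariant differentiation
    becomes right multiplication by A. *)
Theorem moving_frame_exists (A G0 e0 : 'M[R]_n.+1) (p : M) :
  (forall i j, bform (gram g p) (row i e0) (row j e0) = G0 i j) ->
  A *m G0 + G0 *m A^T = 0 ->
  exists (c : chart M) (a : R) (x : R -> 'rV[R]_n.+1) (V : R -> 'M[R]_n.+1),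
  let I := [set t : R | `|t| < a] in
  let gam := psi c \o x in
  let E u := chart_lift c x (fun s => u *m V s) in
  [/\ 0 < a /\ gam 0 = p, (forall t, I t -> (phi c @` dom c) (x t)),
    smooth I x /\ smooth I V,
    (forall t, I t -> velocity gam t = E (delta_mx 0 0) t) &
    forall t, I t ->
      (forall u, cov_along nabla gam (E u) t = E (u *m A) t) /\
      (forall u v, bform (gram g (gam t)) (E u t) (E v t) = bform G0 u v)].
Proof.
move=> e0G AG0; have nablaC := lc_connection nablaP.
pose c := chart_at p; have cp : dom c p by exact: dom_chart_at.
have [a [x [V]]] := frame_ode nablaC A e0 (img_dom cp).
set Ia := [set t | _] => -[a0 [x0 V0] x_img [x_smooth V_smooth] dxV].
have Ia_open : open Ia by exact: open_norm_lt.
have V_row i (t : R) : Ia t -> is_derive t 1 (fun s => row i (V s))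
    (row i (A *m V t) - christoffel c nabla (row 0 (V t)) (row i (V t)) (x t)).
  move=> It; have [_ dV] := dxV t It.
  by have := is_derive_linear_mx (row i) dV; rewrite linearB /= rowK.
pose gam := psi c \o x.
pose e i := chart_lift c x (fun s => row i (V s)).
pose E u := chart_lift c x (fun s => u *m V s).
have E_sum u t : Ia t -> E u t = \sum_i u 0 i *: e i t.
  move=> It; rewrite /E /e /chart_lift mulmx_sum_row const_field_sum//.
  exact: (curve_dom x_img It).
have vel t : Ia t -> velocity gam t = E (delta_mx 0 0) t.
  move=> It; rewrite /gam (chart_curve_velocity x_smooth x_img It) /E
    /chart_lift -rowE.
  by have [[_ ->] _] := dxV t It.
have cov_E t u : Ia t -> cov_along nabla gam (E u) t = E (u *m A) t.
  move=> It; have [[_ dxE] dV] := dxV t It.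
  have [dVu dVuE] := is_derive_linear_mx (mulmx u) dV.
  rewrite /gam /E (cov_along_lift_christoffel Ia_open x_smooth x_img nablaC It
    dVu).
  rewrite /chart_lift dxE dVuE /= mulmxBr [X in _ - X + _]mulmx_sum_row.
  rewrite [X in christoffel _ _ _ X]mulmx_sum_row christoffel_sumr.
  by under [X in _ - X + _]eq_bigr do rewrite rowK; rewrite subrK mulmxA.
have cov_e t i : Ia t -> cov_along nabla gam (e i) t = \sum_j A i j *: e j t.
  move=> It; have -> : e i = E (delta_mx 0 i).
    by rewrite /e /E; congr (chart_lift c x _); apply/funext => s; rewrite rowE.
  rewrite cov_E// E_sum// -rowE.
  by apply: eq_bigr => j _; rewrite mxE.
pose Gm t : 'M[R]_n.+1 := \matrix_(i, j) bform (gram g (gam t)) (e i t) (e j t).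
have dGm (t : R) : Ia t -> is_derive t 1 Gm (A *m Gm t + Gm t *m A^T).
  move=> It; apply: is_derive_mx => i j.
  have [dVi _] := V_row i t It; have [dVj _] := V_row j t It.
  have := is_derive_inner Ia_open x_smooth x_img nablaP It dVi dVj.
  rewrite -/(e i) -/(e j) -/gam (cov_e t i It)
    (cov_e t j It) bform_suml bform_sumr => h.
  have -> : (fun y => Gm y i j) = fun s =>
    bform (gram g (psi c (x s))) (e i s) (e j s).
    by apply/funext => s; rewrite mxE.
  apply: is_derive_eq h _; rewrite !mxE; congr (_ + _); apply: eq_bigr => k _.
    by rewrite mxE.
  by rewrite !mxE mulrC.
have L_linear : linear (fun X : 'M[R]_n.+1 => A *m X + X *m A^T).
  by move=> r u v; rewrite mulmxDr mulmxDl scalerDr -scalemxAr -scalemxAl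
    addrACA.
pose LM := GRing.isLinear.Build _ _ _ _ _ L_linear.
pose L : {linear 'M[R]_n.+1 -> 'M[R]_n.+1} :=
  HB.pack (fun X : 'M[R]_n.+1 => A *m X + X *m A^T) LM.
have [b /andP[b0 ba] zero] := linear_ode_zero L a0.
have gam0 : gam 0 = p by rewrite /gam /= x0 phiK.
have Gm0 : Gm 0 - G0 = 0.
  have e_0 k : e k 0 = row k e0.
    by rewrite /e /chart_lift x0 V0 phiK// const_fieldE Jac_id.
  by apply/matrixP => i j; rewrite !mxE -e0G !e_0 gam0 subrr.
have GmE t : `|t| < b -> Gm t = G0.
  move=> tb; apply/eqP; rewrite -subr_eq0; apply/eqP.
  apply: (zero (fun t => Gm t - G0)) => // s sa.
  have -> : L (Gm s - G0) = A *m Gm s + Gm s *m A^T - 0.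
    have LE X : L X = A *m X + X *m A^T by [].
    by rewrite linearB !LE AG0.
  by apply: is_deriveB; exact: dGm.
have ba_sub : [set t : R | `|t| < b] `<=` Ia.
  by move=> t /= tb; exact: lt_le_trans tb ba.
exists c, b, x, V; split=> //.
- by move=> t /ba_sub; exact: x_img.
- by split=> k; [exact: Ck_subset ba_sub (x_smooth k)
                |exact: Ck_subset ba_sub (V_smooth k)].
- by move=> t /ba_sub; exact: vel.
- move=> t tb; split=> [u|u v]; first exact/cov_E/ba_sub.
  have It := ba_sub t tb.
  rewrite -[chart_lift _ _ _ t]/(E u t).
  rewrite -[chart_lift _ _ (fun s => v *m _) t]/(E v t) !E_sum//.
  rewrite [in RHS](row_sum_delta u) [in RHS](row_sum_delta v) !bform_suml.
  apply: eq_bigr => i _; congr (_ * _); rewrite !bform_sumr.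
  apply: eq_bigr => j _; congr (_ * _).
  by rewrite bform_delta -(GmE t tb) mxE.
Qed.

End MovingFrames.

(** * Null helices *)

Section FrenetMatrix.
Context {R : realType}.

Definition mx3 (l : seq (seq R)) : 'M[R]_3 :=
  \matrix_(i, j) nth 0 (nth [::] l i) j.

(** Row i contains the components of the covariant derivative of the i-th frame
    vector, in the order zeta, N, W. *)
Definition frenet_mx (h k1 k2 : R) : 'M[R]_3 :=
  mx3 [:: [:: h; 0; k1]; [:: 0; - h; k2]; [:: k2; k1; 0]].

Definition null_gram : 'M[R]_3 :=
  mx3 [:: [:: 0; 1; 0]; [:: 1; 0; 0]; [:: 0; 0; -1]].

Lemma mx3_ord (P : 'I_3 -> Prop) :
  P (@Ordinal 3 0 isT) -> P (@Ordinal 3 1 isT) -> P (@Ordinal 3 2 isT) ->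
    forall i, P i.
Proof.
by move=> P0 P1 P2 [[|[|[|//]]] lt_i]; [move: P0|move: P1|move: P2];
  congr P; exact: val_inj.
Qed.

(** The matrix is skew for the Gram matrix of a null frame, as differentiating
    the constant inner products of the frame requires. *)
Lemma frenet_mx_gram h k1 k2 :
  frenet_mx h k1 k2 *m null_gram + null_gram *m (frenet_mx h k1 k2)^T = 0.
Proof.
apply/matrixP; elim/mx3_ord; elim/mx3_ord;
  rewrite !mxE !big_ord_recl !big_ord0 !mxE /=; ring.
Qed.

(** The Cayley-Hamilton identity of a matrix with zero trace and determinant. *)
Lemma frenet_mx_cube h k1 k2 (A := frenet_mx h k1 k2) :
  A *m A *m A = (h ^+ 2 + 2 * k1 * k2) *: A.
Proof.
apply/matrixP; elim/mx3_ord; elim/mx3_ord;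
  rewrite !mxE !big_ord_recl !big_ord0 !mxE !big_ord_recl !big_ord0 !mxE /=;
    ring.
Qed.

End FrenetMatrix.

Section NullHelices.
Context {R : realType} {M : manifold R 3}.
Variables (g : metric M 2) (nabla : vfield M -> vfield M -> vfield M).
Hypothesis nablaP : is_levi_civita g nabla.

Local Notation d0 := (delta_mx 0 (@Ordinal 3 0 isT)).
Local Notation d1 := (delta_mx 0 (@Ordinal 3 1 isT)).
Local Notation d2 := (delta_mx 0 (@Ordinal 3 2 isT)).

(** The screen is the line of W. The last clause is what the Gauss formula needs:
    the product of the velocity with a field is its N-component. *)
Theorem null_helix_exists (h k1 k2 : R) (p : M) : h != 0 -> k1 != 0 ->
  k2 != 0 ->
  exists (c : chart M) (a : R) (x : R -> 'rV[R]_3) (V : R -> 'M[R]_3),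
  let I := [set t : R | `|t| < a] in
  let gam := psi c \o x in
  let E u := chart_lift c x (fun s => u *m V s) in
  [/\ 0 < a /\ gam 0 = p, (forall t, I t -> (phi c @` dom c) (x t)),
    smooth I x /\ smooth I V,
    null_helix g nabla I gam (fun t => <<E d2 t>>%MS) (E d1) (E d2) h k1 k2 &
    forall t, I t -> velocity gam t = E d0 t /\
      forall u, cov_along nabla gam (E u) t = E (u *m frenet_mx h k1 k2) t /\
        inner g (velocity gam t : tangent (gam t)) (E u t) =
          u 0 (@Ordinal 3 1 isT)].
Proof.
move=> h0 k10 k20.
have [z [m [w zmw]]] :=
  null_triple_exists (gram_sym g p) (gram_nondegenerate g p) (gram_index g p).
pose e0 : 'M[R]_3 := \matrix_i nth 0 [:: z; m; w] i.
have e0G i j : bform (gram g p) (row i e0) (row j e0) = null_gram i j.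
  have [zz zm mm [zw mw ww]] := zmw; have Gs := gram_sym g p.
  by move: i j; elim/mx3_ord; elim/mx3_ord; rewrite !rowK mxE /=;
    first [assumption | rewrite (bform_sym _ _ Gs); assumption].
have [c [a [x [V]]]] := moving_frame_exists nablaP e0G (frenet_mx_gram h k1 k2).
set I := [set t | _]; set gam := psi c \o x =>
  /= -[[a0 gam0] x_img [xs Vs] vel frame].
pose E u := chart_lift c x (fun s => u *m V s).
have I_open : open I by exact: open_norm_lt.
have velE t : I t -> velocity gam t = E d0 t.
  have i0 : 0 = @Ordinal 3 0 isT by exact: val_inj.
  by move=> It; rewrite vel// i0.
have E_smooth u : along_smooth I gam (E u).
  apply: (lift_smooth I_open xs x_img) => k.
  exact: (Ck_linear_mx (mulmx u)).
have triple t : I t -> null_triple (gram g (gam t)) (E d0 t) (E d1 t) (E d2 t).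
  move=> It; have [_ EG] := frame t It.
  by split; last split; apply: etrans (EG _ _) _; rewrite bform_delta mxE.
have E_lin t (r s : R) u v : I t ->
  E (r *: u + s *: v) t = r *: E u t + s *: E v t.
  move=> It; rewrite -(lift_linear x_img r s (fun y => u *m V y) (fun y =>
    v *m V y) It).
  by rewrite /E /chart_lift mulmxDl -!scalemxAl.
exists c, a, x, V; split=> //; last first.
  move=> t It; split=> [|u]; first exact: velE.
  have [covE EG] := frame t It; split; first exact: covE.
  rewrite velE// /inner EG /bform -rowE mxE big_ord_recl big_ord_recl
    big_ord_recl big_ord0.
  have i1 : lift ord0 ord0 = @Ordinal 3 1 isT by exact: val_inj.
  by rewrite !mxE /= !mul0r add0r mul1r !addr0 i1.
have cov_row t (i : 'I_3) (r s : R) u v : I t ->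
    delta_mx 0 i *m frenet_mx h k1 k2 = r *: u + s *: v ->
    cov_along nabla gam (E (delta_mx 0 i)) t = r *: E u t + s *: E v t.
  move=> It dE; have [covE _] := frame t It.
  by rewrite -(E_lin t r s u v It) -dE; exact: covE.
split=> //.
- split=> //.
  + move=> s t /=; rewrite !ltr_norml =>
    /andP[s1 s2] /andP[t1 t2] r /andP[sr rt].
    by rewrite ltr_norml (lt_le_trans s1 sr) (le_lt_trans rt t2).
  + by exists 0; rewrite /I /= normr0.
  + exact: chart_curve_smooth.
  + move=> t It; have [zz zn _ _] := triple t It; rewrite velE//; split=> //.
    by apply/eqP => z0; move: zn; rewrite z0 bform0l => /eqP;
      rewrite eq_sym oner_eq0.
- move=> t It /=; have := null_triple_screen (gram_sym g (gam t)) (triple t It).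
  by rewrite velE.
- split; [exact: E_smooth|exact: E_smooth|move=> t It /=].
  have [zz zn nn [zw nw ww]] := triple t It; split.
  + by rewrite (velE t It); exact: zn.
  + exact: nn.
  + move=> v; rewrite genmxE => /sub_rVP[b ->].
    by rewrite /inner bformZr [X in b * X]nw mulr0.
  + by rewrite genmxE submx_refl.
  + exact: ww.
- move=> t It /=.
  have -> : cov_along nabla gam (velocity gam) t = cov_along nabla gam (E d0) t.
    by apply: cov_along_near; apply: filterS (near_I I_open It) => s;
      exact: velE.
  rewrite velE//; split; apply: cov_row => //; rewrite -rowE; apply/rowP;
    elim/mx3_ord; rewrite !mxE /=; ring.
Qed.

End NullHelices.

(** * Vanishing of the mean curvature *)

Theorem theorem3 (R : realType)
  (M : manifold R 3) (M' : manifold R 4)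
  (g : metric M 2) (g' : metric M' 2)
  (nabla : vfield M -> vfield M -> vfield M)
  (nabla' : vfield M' -> vfield M' -> vfield M')
  (f : M -> M') (B : tensor_along f) (H : forall p : M, tangent (f p))
  (nablaP : is_levi_civita g nabla)
  (nablaP' : is_levi_civita g' nabla')
  (f_immersion : isometric_immersion g g' f)
  (B_sff : is_second_fundamental_form g' nabla nabla' B)
  (H_mean : is_mean_curvature g B H)
  (B_umbilical : totally_umbilical g B H)
  (helices : forall (I : set R) (gam : R -> M) (S : R -> 'M[R]_3)
      (N W : R -> 'rV[R]_3) (h k1 k2 : R),
    null_helix g nabla I gam S N W h k1 k2 ->
    let zeta := fun t => dmap f (velocity gam t : tangent (gam t)) in
    let D := cov_along nabla' (f \o gam) in
    forall t, I t ->
      D (D (D zeta)) t = (h ^+ 2 + 2 * k1 * k2) *: D zeta t) :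
  (forall p (v : tangent p), lightlike g v -> B p v v = 0) /\
  (forall p, H p = 0).
Proof.
split=> [p v [_ vv]|p]; first by rewrite B_umbilical vv scale0r.
have nablaC := lc_connection nablaP; have nablaC' := lc_connection nablaP'.
have [f_smooth _ _] := f_immersion.
have one0 : (1 : R) != 0 := oner_neq0 R.
have [c [a [x [V]]]] := null_helix_exists nablaP p one0 one0 one0.
set I := [set t | _]; set gam := psi c \o x.
set A := frenet_mx _ _ _; pose E u := chart_lift c x (fun s => u *m V s).
move=> /= -[[a0 gam0] x_img [xs Vs] helix frame].
have I_open : open I by exact: open_norm_lt.
(* FE u is the image of the tangent field with constant components u in the
   frame zeta, N, W; D multiplies u by A and adds its N-component times H. *)
pose FE u s := dmap f (E u s : tangent (gam s)).
pose D := cov_along nabla' (f \o gam).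
have D_FE u t : I t -> D (FE u) t =
    (FE (u *m A) t : 'rV[R]_4) +
    u 0 (@Ordinal 3 1 isT) *: (H (gam t) : 'rV[R]_4).
  move=> It; have [_ frame_u] := frame t It; have [covE inE] := frame_u u.
  have dVu : derivable (fun s => u *m V s) t 1.
    have dV := Ck_is_derive (1 : R) (Vs 1%N) It.
    by case: (is_derive_linear_mx (mulmx u) dV).
  rewrite /D (gauss_along f_smooth I_open xs x_img nablaC nablaC' B_sff
    B_umbilical It dVu).
  by rewrite covE inE.
have D_near (Z Z' : R -> 'rV[R]_4) t : I t -> (forall s, I s -> Z s = Z' s) ->
  D Z t = D Z' t.
  by move=> It ZZ'; apply: cov_along_near; apply: filterS (near_I I_open It).
pose d : 'rV[R]_3 := delta_mx 0 (@Ordinal 3 0 isT).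
pose zeta s := dmap f (velocity gam s : tangent (gam s)).
have I0 : I 0 by rewrite /I /= normr0.
have D0 : D (D (D zeta)) 0 = (1 ^+ 2 + 2 * 1 * 1) *: D zeta 0.
  exact: helices helix 0 I0.
have zetaE t : I t -> zeta t = FE d t.
  by move=> It; have [vE _] := frame t It; rewrite /zeta vE.
have FE_scale r u : FE (r *: u) 0 = r *: (FE u 0 : 'rV[R]_4).
  have E_scale : E (r *: u) 0 = r *: E u 0 + 0.
    have := lift_linear x_img r 0 (fun y => u *m V y) (fun y => u *m V y) I0.
    rewrite scale0r => <-; rewrite /E /chart_lift scale0r addr0 -scalemxAl //.
  by rewrite /FE E_scale (dmapP f_smooth) dmap0 addr0.
clearbody D zeta FE.
have D1 t : I t -> D zeta t = FE (d *m A) t.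
  move=> It; rewrite (D_near _ _ _ It zetaE) (D_FE _ _ It).
  by rewrite mxE /= scale0r addr0.
have D2 t : I t -> D (D zeta) t = FE (d *m A *m A) t.
  move=> It; rewrite (D_near _ _ _ It D1) (D_FE _ _ It).
  by rewrite -rowE !mxE /= scale0r addr0.
have dAA : (d *m A *m A) 0 (@Ordinal 3 1 isT) = 1.
  by rewrite -mulmxA -rowE !mxE !big_ord_recl big_ord0 !mxE /=; ring.
have dAAA : d *m A *m A *m A = (1 ^+ 2 + 2 * 1 * 1) *: (d *m A).
  by rewrite -!mulmxA [A *m (A *m A)]mulmxA frenet_mx_cube -scalemxAr.
move: D0; rewrite (D_near _ _ _ I0 D2)
  (D_FE _ _ I0) dAAA FE_scale dAA scale1r (D1 _ I0).
by rewrite -[RHS]addr0 gam0 => /addrI.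
Qed.
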